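(* Let $\alpha\notin\mathbb Q$, let $(q_n)_{n\ge1}$ be a subsequence of the denominators of the convergents of $\alpha$, and let $(b_n)_{n\ge1}$ be a sequence of non-zero integers. For every $\beta\in\mathbb R$ such that $\beta=\sum_{n\ge1}b_nq_n\alpha\mod 1$, the following hold. - If $\displaystyle\sum_{n\ge1}\left(|b_n|\,q_n^{k+1}\|q_n\alpha\|\right)^{1/(k+2)}<\infty$ ($k\in\mathbb N$), then $\phi_\beta$ is additively cohomologous to a function $\psi\in C^k(\mathbb T)$ of arbitrarily small sup norm. - If $\displaystyle\sum_{n\ge1}\frac{q_n\ln(n|b_n|)}{-\ln(\|q_n\alpha\|)}<\infty$, then $\phi_\beta$ is additively cohomologous to a function $\psi\in C^\omega(\mathbb T)$ of arbitrarily small sup norm.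
   Context: $\mathbb T=\mathbb R/\mathbb Z$, $T$ is the translation by $\alpha$ on $\mathbb T$, $\|x\|$ is the distance to the nearest integer, $\{x\}$ the fractional part, and $\phi_\beta=\mathbf 1_{[0,\{\beta\}[}-\{\beta\}$ on $\mathbb T$. Two real measurable functions $\phi,\psi$ on $\mathbb T$ are additively cohomologous if there is a real measurable $f$ with $\phi-\psi=f-f\circ T$ almost everywhere. ''Of arbitrarily small sup norm'' means: for every $\varepsilon>0$, $\psi$ can be chosen with $\|\psi\|_\infty<\varepsilon$. The equality ''mod 1'' means that the series converges in $\mathbb T$ to $\beta$ mod 1. *)

(* Defs.v *)
From HB Require Import structures.
From mathcomp Require Import all_boot all_order all_algebra.
From mathcomp Require Import all_classical all_reals all_analysis.

Set Implicit Arguments.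
Unset Strict Implicit.
Unset Printing Implicit Defensive.

Import Order.TTheory GRing.Theory Num.Theory.
Import numFieldNormedType.Exports.
Local Open Scope classical_set_scope.
Local Open Scope ring_scope.

(* A function on the circle T = R/Z is represented by a
   1-periodic function R -> R; Lebesgue-null sets of T then correspond to
   1-periodic Lebesgue-null sets of R. *)

Definition frac (R : realType) (x : R) : R := x - (Num.floor x)%:~R.

Definition dist_int (R : realType) (x : R) : R :=
  inf [set `|x - m%:~R| | m in [set: int]].

(* For irrational [alpha], [cf_complete alpha n] is the [n]-th complete quotient
   of the regular continued fraction [a_0; a_1, a_2, ...] of [alpha]. *)
Fixpoint cf_complete (R : realType) (alpha : R) (n : nat) : R :=
  if n is m.+1 then (frac (cf_complete alpha m))^-1 else alpha.

Definition cf_quotient (R : realType) (alpha : R) (n : nat) : int :=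
  Num.floor (cf_complete alpha n).

(* Denominator of the convergent [a_0; a_1, ..., a_n]. *)
Fixpoint cf_den (R : realType) (alpha : R) (n : nat) : int :=
  match n with
  | 0 => 1
  | m.+1 => match m with
            | 0 => cf_quotient alpha 1
            | l.+1 => cf_quotient alpha n * cf_den alpha m + cf_den alpha l
            end
  end.

(* Sequences are indexed by n >= 1: the values [q 0] and [sigma 0] are
   irrelevant. *)
Definition cf_den_subsequence (R : realType) (alpha : R) (q : nat -> int) :=
  exists sigma : nat -> nat,
    (forall m n, (1 <= m)%N -> (m < n)%N -> (sigma m < sigma n)%N) /\
    (forall n, (1 <= n)%N -> q n = cf_den alpha (sigma n)).

(* Convergence in R/Z of the series of the u_n, n >= 1, to x mod 1. *)
Definition series_mod1 (R : realType) (u : nat -> R) (x : R) : Prop :=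
  dist_int (\sum_(1 <= n < N.+1) u n - x) @[N --> \oo] --> (0 : R).

Definition phi (R : realType) (beta : R) (x : R) : R :=
  \1_(`[0, frac beta[%classic) (frac x) - frac beta.

Definition additively_cohomologous (R : realType) (alpha : R)
    (g h : R -> R) : Prop :=
  exists f : R -> R,
    [/\ periodic f 1, measurable_fun [set: R] f
      & {ae @lebesgue_measure R,
          forall x, g x - h x = f x - f (x + alpha)}].

Definition Ck_circle (R : realType) (k : nat) (psi : R -> R) : Prop :=
  [/\ periodic psi 1,
      forall j, (j < k)%N -> forall x, derivable (derive1n j psi) x 1
    & continuous (derive1n k psi)].

Definition analytic_circle (R : realType) (psi : R -> R) : Prop :=
  periodic psi 1 /\
  forall x0, exists (a : nat -> R) (r : R), 0 < r /\
    forall h, `|h| < r -> pseries a h @ \oo --> psi (x0 + h).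

Definition sup_norm (R : realType) (psi : R -> R) : \bar R :=
  ereal_sup [set (`|psi x|)%:E | x in [set: R]].

(* Main.v *)
Require Import Defs.
From HB Require Import structures.
From mathcomp Require Import all_boot all_order all_algebra.
From mathcomp Require Import all_classical all_reals all_analysis.
From mathcomp Require Import measurable_realfun.
From mathcomp Require Import ring lra zify.
Set Implicit Arguments.
Unset Strict Implicit.
Unset Printing Implicit Defensive.
Import Order.TTheory GRing.Theory Num.Theory.
Import numFieldNormedType.Exports.
Local Open Scope classical_set_scope.
Local Open Scope ring_scope.

(** Let [s] be the sawtooth [frac - 1/2].  Then
    [phi beta x = s (x - beta) - s x], so with [m_n = b_n q_n] and the partial
    sums [G_n] of the series of [m_i alpha] (which converge to [beta] modulo 1)
    the function [phi beta] is the telescoping sum of the increments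
    [s (x - G_(n+1)) - s (x - G_n)].  Each increment is the coboundary of a
    Birkhoff sum of [s] of length [|m_n|]; these transfer functions do not add
    up, but they do once [s] is replaced at step [n] by the error [s - u_n] of
    a smooth approximation [u_n].  What is left is
    [psi = sum of u_n (x - G_(n+1)) - u_n (x - G_n)], and it suffices that
    these smooth increments are summable in the desired class while the
    Birkhoff sums of the errors are summable almost everywhere
    ([cohomologous_of_smoothing]).  Taking [u_n = 0] for the first steps only
    changes the transfer function and makes [psi] as small as desired.

    Summability of the transfer functions ([ae_cvg_birkhoff]).  If [s - u_n] is
    small at distance [delta] from the integers, its Birkhoff sum of length
    [|b_n| q_n] is small unless the orbit comes close to the jump.  Since [q_n]
    steps move a point by [||q_n alpha||] only, the [|b_n| q_n] points cluster
    around [q_n] of them, and the exceptional set has measure of order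
    [q_n (delta + |b_n| ||q_n alpha||)].  If these measures are summable, and
    the integrals of the errors off the exceptional sets are too, the series
    converges almost everywhere.

    Class [C^k] ([smooth_sawtooth]).  An average of [s] of order [k + 1] over
    windows of size [delta / q_n] coincides with [s] at distance [delta / q_n]
    from the jump, and its increments by [b_n q_n alpha] are of order
    [|b_n| ||q_n alpha|| (q_n / delta)^(k+1)] in [C^k].  This is equal to
    [delta] for [delta = (|b_n| q_n^(k+1) ||q_n alpha||)^(1/(k+2))].

    Analytic class ([analytic_smoothing]).  Now [u_n] is a trigonometric
    polynomial of degree at most [L / 4], where [L = - ln ||q_n alpha||]: on a
    fixed strip its growth cannot compensate the factor [||q_n alpha|| = exp (- L)].
    It is the primitive of [1 - K], with [K] a normalized power of exponent [l]
    of a Fejer kernel of degree about [L / l].  The error is concentrated at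
    distance [l / L] from the jump and its integral beyond is of order
    [4^(-l) l / L] up to a polynomial factor in [l], which beats the number
    [|b_n|] of visits when [2^l >= |b_n|].  All bounds are then of order
    [q_n l / L], and [l] is comparable to [ln (n |b_n|)]. *)

Local Notation frac := Defs.frac.

(** * Distance to the integers and the fractional part *)

Section circle.
Variable R : realType.
Implicit Types (x y a : R) (m : int).

Lemma frac_itv x : 0 <= frac x < 1.
Proof.
have := floor_itv x; rewrite /frac intrD => /andP[h1 h2].
by apply/andP; split; lra.
Qed.

Lemma frac_id x : 0 <= x < 1 -> frac x = x.
Proof. by move=> x01; rewrite /frac (@floor_def _ _ 0) ?subr0// add0r. Qed.

Lemma fracDz x m : frac (x + m%:~R) = frac x.
Proof.
rewrite /frac floorDrz ?rpred_int // intrD intrKfloor.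
by rewrite opprD addrACA subrr addr0.
Qed.

Lemma frac_eq x y m : y = x + m%:~R -> frac y = frac x.
Proof. by move=> ->; exact: fracDz. Qed.

Lemma periodic_int (f : R -> R) x m : periodic f 1 -> f (x + m%:~R) = f x.
Proof.
move=> pf; have pn (k : nat) y : f (y + k%:R) = f y by exact: periodicn.
case: m => k; first exact: pn.
by rewrite NegzE mulrNz -[LHS](pn k.+1) -pmulrn subrK.
Qed.

Lemma dist_int_le x m : dist_int x <= `|x - m%:~R|.
Proof.
apply: ge_inf; last by exists m.
by exists 0 => _ [k _ <-].
Qed.

Lemma dist_intP x : exists m, dist_int x = `|x - m%:~R|.
Proof.
have /andP[f0 f1] := frac_itv x.
have nearest m : (forall k, `|x - m%:~R| <= `|x - k%:~R|) ->
    dist_int x = `|x - m%:~R|.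
  move=> mk; apply/eqP; rewrite eq_le dist_int_le /=.
  by apply: lb_le_inf => [|_ [k _ <-]//]; exists `|x - m%:~R|; exists m.
have hk k : `|x - k%:~R| = `|frac x - (k - Num.floor x)%:~R|.
  by congr `|_|; rewrite /frac intrB; lra.
have [h|h] := leP (frac x) (1 - frac x).
  exists (Num.floor x); apply: nearest => k.
  rewrite !hk subrr subr0 (ger0_norm f0).
  have [k0|k0] := leP (k - Num.floor x) 0.
    rewrite ger0_norm; have : (k - Num.floor x)%:~R <= 0 :> R by rewrite lerz0.
      lra.
    lra.
  have : 1 <= (k - Num.floor x)%:~R :> R by rewrite ler1z.
  move=> h1; rewrite ler0_norm; lra.
exists (Num.floor x + 1); apply: nearest => k.
rewrite !hk (_ : Num.floor x + 1 - Num.floor x = 1); last by lia.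
rewrite (ler0_norm (_ : frac x - 1 <= 0)); last by lra.
have [k0|k0] := leP (k - Num.floor x) 0.
  rewrite ger0_norm; have : (k - Num.floor x)%:~R <= 0 :> R by rewrite lerz0.
    lra.
  lra.
have : 1 <= (k - Num.floor x)%:~R :> R by rewrite ler1z.
move=> h1; rewrite ler0_norm; lra.
Qed.

Lemma dist_int_ge0 x : 0 <= dist_int x.
Proof. by have [m ->] := dist_intP x. Qed.

Lemma dist_int_le_half x : dist_int x <= 1 / 2.
Proof.
have := dist_int_le x (Num.floor x); have := dist_int_le x (Num.floor x + 1).
have /andP[] := floor_itv x; rewrite !intrD => h1 h2.
rewrite (ger0_norm (_ : 0 <= x - (Num.floor x)%:~R)); last lra.
by rewrite (ler0_norm (_ : x - ((Num.floor x)%:~R + 1%:~R) <= 0)); lra.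
Qed.

Lemma dist_intD x y : dist_int (x + y) <= dist_int x + dist_int y.
Proof.
have [m ->] := dist_intP x; have [k ->] := dist_intP y.
apply: le_trans (dist_int_le _ (m + k)) _.
by apply: le_trans (ler_normD _ _); rewrite intrD opprD addrACA.
Qed.

Lemma dist_intN x : dist_int (- x) = dist_int x.
Proof.
suff le y : dist_int (- y) <= dist_int y.
  by apply/eqP; rewrite eq_le le /= -{1}[x]opprK le.
have [m ->] := dist_intP y.
by apply: le_trans (dist_int_le _ (- m)) _; rewrite mulrNz -opprD normrN.
Qed.

Lemma dist_intMn x n : dist_int (n%:R * x) <= n%:R * dist_int x.
Proof.
elim: n => [|n IH]; first by rewrite !mul0r (le_trans (dist_int_le _ 0))// subrr normr0.
rewrite -natr1 !mulrDl !mul1r.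
by apply: le_trans (dist_intD _ _) _; rewrite lerD2r.
Qed.

Lemma dist_intMz x m : dist_int (m%:~R * x) <= `|m%:~R| * dist_int x.
Proof.
case: m => n; first by rewrite ger0_norm; [exact: dist_intMn | rewrite ler0n].
rewrite NegzE mulrNz mulNr dist_intN normrN ger0_norm; first exact: dist_intMn.
by rewrite ler0n.
Qed.

(** The additive cocycle [phi beta] is the translation defect of the sawtooth:
    this makes it telescope along partial sums of [beta]. *)
Lemma phiE beta x : phi beta x = frac (x - beta) - frac x.
Proof.
have /andP[x0 x1] := frac_itv x; have /andP[b0 b1] := frac_itv beta.
have shift : frac (x - beta) = frac (frac x - frac beta).
  apply: (@frac_eq _ _ (Num.floor x - Num.floor beta)).
  by rewrite /frac intrB; lra.
rewrite /phi shift indicE; have [lt|le] := ltP (frac x) (frac beta).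
  have -> : frac x \in `[0, frac beta[%classic.
    by rewrite mem_set //= in_itv /= x0.
  rewrite -(@fracDz (frac x - frac beta) 1) (@frac_id (frac x - frac beta + 1%:~R)).
    by rewrite mulr1n; lra.
  by apply/andP; split; lra.
rewrite memNset /=; last by rewrite in_itv /= x0 => /lt_geF; rewrite le.
rewrite (@frac_id (frac x - frac beta)); first by rewrite mulr0n; lra.
by apply/andP; split; lra.
Qed.

End circle.

(** * Series of functions *)

Section series.
Variable R : realType.
Implicit Types (f M : nat -> R).

Lemma dominated_series_cvg f M : (forall n, `|f n| <= M n) ->
  cvgn (series M) -> cvgn (series f).
Proof.
move=> fM cM; apply: normed_cvg; by apply: series_le_cvg cM => // n /=; rewrite ?(le_trans _ (fM n)).
Qed.

Lemma dominated_series_le f M : (forall n, `|f n| <= M n) ->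
  cvgn (series M) -> `|limn (series f)| <= limn (series M).
Proof.
move=> fM cM.
have cn : cvgn [normed series f].
  by apply: series_le_cvg cM => // n /=; rewrite ?(le_trans _ (fM n)).
by apply: le_trans (lim_series_norm cn) _; apply: lim_series_le.
Qed.

Lemma series_shift f N n :
  series (fun k => f (N + k)%N) n = series f (N + n)%N - series f N.
Proof.
rewrite /series /= (big_cat_nat (n := N) (p := (N + n)%N)) ?leq_addr//=.
rewrite addrAC subrr add0r -{2}[N]add0n [(N + n)%N]addnC big_addn addnK.
by apply: eq_bigr => i _; rewrite addnC.
Qed.

Lemma cvg_series_shift f N : cvgn (series f) ->
  series (fun k => f (N + k)%N) @ \oo --> limn (series f) - series f N.
Proof.
move=> cf.
have -> : series (fun k => f (N + k)%N) =
    (fun n => series f (n + N)%N - series f N).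
  by apply/funext => n; rewrite series_shift addnC.
apply: cvgB; last exact: cvg_cst.
by rewrite (cvg_shiftn N).
Qed.

Lemma series_tail_le f M N : (forall n, `|f n| <= M n) ->
  cvgn (series M) ->
  `|limn (series f) - series f N| <= limn (series M) - series M N.
Proof.
move=> fM cM.
have tM := @cvg_series_shift M N cM.
have tf := @cvg_series_shift f N (dominated_series_cvg fM cM).
rewrite -(cvg_lim (@Rhausdorff R) tM) -(cvg_lim (@Rhausdorff R) tf).
by apply: dominated_series_le => //; apply/cvg_ex; eexists; exact: tM.
Qed.

Lemma series_tail_lt M e : cvgn (series M) -> 0 < e ->
  exists N, limn (series M) - series M N < e.
Proof.
move=> cM e0; move/cvgrPdist_lt: cM => /(_ _ e0) [N _ /(_ N (leqnn N)) /=].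
by move=> /ltr_normlW h; exists N.
Qed.

Lemma nonneg_series_tail M N : (forall n, 0 <= M n) -> cvgn (series M) ->
  series M N <= limn (series M).
Proof.
move=> M0 cM; rewrite -subr_ge0; apply: le_trans (@series_tail_le M M N _ cM) => //.
by move=> n; rewrite ger0_norm.
Qed.

Lemma cvg_series_eventually f g N : (forall n, (N <= n)%N -> f n = g n) ->
  cvgn (series f) -> cvgn (series g).
Proof.
move=> fg cf; apply/cvg_ex; exists (limn (series f) - series f N + series g N).
rewrite -(cvg_shiftn N).
have -> : (fun n => series g (n + N)%N) =
    (fun n => series (fun k => f (N + k)%N) n + series g N).
  apply/funext => n; rewrite addnC.
  have -> : series (fun k => f (N + k)%N) = series (fun k => g (N + k)%N).
    by congr series; apply/funext => k; rewrite fg ?leq_addr.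
  by rewrite series_shift subrK.
by apply: cvgD; [exact: cvg_series_shift | exact: cvg_cst].
Qed.

Lemma cvg_series_cut M N : cvgn (series M) ->
  series (fun n => if (n < N)%N then 0 else M n) @ \oo -->
  limn (series M) - series M N.
Proof.
move=> cM; rewrite -(cvg_shiftn N).
rewrite (_ : (fun n => _) = series (fun k => M (N + k)%N)).
  exact: cvg_series_shift.
apply/funext => n; rewrite addnC -[LHS]subr0.
rewrite -[X in _ - X](_ : series (fun n => if (n < N)%N then 0 else M n) N = 0).
  rewrite -series_shift; congr (series _ n); apply/funext => k.
  by rewrite ltnNge leq_addr.
by rewrite /series /= big_nat big1// => k /= ->.
Qed.

Lemma cvg_series_scale M c : cvgn (series M) -> cvgn (series (fun n => c * M n)).
Proof. by move=> cM; exact: (@is_cvg_seriesZ _ _ c). Qed.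

End series.

Section termwise_differentiation.
Variable R : realType.

Lemma derive_lipschitz (f df : R -> R) (C : R) :
  (forall x : R, is_derive x 1 f (df x)) -> (forall x, `|df x| <= C) ->
  forall x y, `|f y - f x| <= C * `|y - x|.
Proof.
move=> fdf dfC.
have H x y : x <= y -> `|f y - f x| <= C * `|y - x|.
  move=> xy; have [|c _ ->] := @MVT_segment _ f df x y xy (fun z _ => fdf z).
    apply: derivable_within_continuous => z _.
    by have [] := fdf z.
  by rewrite normrM ler_wpM2r.
move=> x y; have [/H//|/ltW/H] := leP x y.
by rewrite distrC (distrC x y).
Qed.

(** The remainder after finitely many terms has difference quotients bounded by
    the tail of the dominating series, uniformly in the increment. *)
Lemma is_derive_series (f df : nat -> R -> R) (M : nat -> R) :
  (forall n (x : R), is_derive x 1 (f n) (df n x)) ->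
  (forall n x, `|df n x| <= M n) -> cvgn (series M) ->
  (forall x, cvgn (series (f^~ x))) ->
  forall x : R, is_derive x 1 (fun x => limn (series (f^~ x)))
                          (limn (series (df^~ x))).
Proof.
move=> fdf dfM cM cf x; pose S y := limn (series (f^~ y)).
suff : (fun h => h^-1 *: (S (h + x) - S x)) @ 0^' --> limn (series (df^~ x)).
  move=> cS; have E : S = (fun y => limn (series (f^~ y))) by [].
  rewrite -E; have e0 : (fun h : R => h^-1 *: ((S \o shift x) h%:A - S x)) =
    (fun h => h^-1 *: (S (h + x) - S x)).
    by apply/funext => h /=; rewrite /GRing.scale /= mulr1.
  apply: DeriveDef; first by rewrite /derivable e0; apply/cvg_ex; eexists; exact: cS.
  by rewrite /derive e0; exact/cvg_lim.
apply/cvgrPdist_lt => e e0.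
have e3 : 0 < e / 4 by rewrite divr_gt0.
have [N tN] := series_tail_lt cM e3.
have dP : is_derive x 1 (fun y => series (f^~ y) N) (series (df^~ x) N).
  rewrite /series /=; have := is_derive_sum (n := N) (h := fun i => f i)
    (dh := fun i => df i x) (fun i => fdf i x).
  under [in X in X -> _]eq_fun do [].
  rewrite (_ : (\sum_(i < N) f i) = (fun y => \sum_(0 <= k < N) f k y)); last first.
    by apply/funext => y; rewrite fct_sumE big_mkord.
  by rewrite big_mkord.
have cP : (fun h => h^-1 *: (series (f^~ (h + x)) N - series (f^~ x) N)) @ 0^'
     --> series (df^~ x) N.
  have [/cvg_ex[l cl] <-] := dP; rewrite /derive (cvg_lim _ cl)//.
  by move: cl; under eq_fun do rewrite /= /GRing.scale /= mulr1.
move/cvgrPdist_lt: cP => /(_ _ e3); apply: filter_app.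
near=> h => hP.
have h0 : h != 0 by near: h; exact: nbhs_dnbhs_neq.
have t1 : `|limn (series (df^~ x)) - series (df^~ x) N| < e / 4.
  exact: le_lt_trans (@series_tail_le _ _ _ N (fun n => dfM n x) cM) tN.
have t2 : `|h^-1 *: ((S (h + x) - S x)
     - (series (f^~ (h + x)) N - series (f^~ x) N))| <= e / 4.
  have gM n : `|f n (h + x) - f n x| <= `|h| * M n.
    have := derive_lipschitz (fdf n) (dfM n) x (h + x).
    by rewrite addrK mulrC.
  have := @series_tail_le _ _ _ N gM (@cvg_series_scale _ M `|h| cM).
  have -> : series (fun n => f n (h + x) - f n x) =
      (fun n => series (f^~ (h + x)) n - series (f^~ x) n).
    by apply/funext => n; rewrite /series /= sumrB.
  have -> : series (fun n => `|h| * M n) = (fun n => `|h| * series M n).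
    by apply/funext => n; rewrite /series /= mulr_sumr.
  rewrite (_ : limn (fun n => _ - _) = S (h + x) - S x); last first.
    by apply: cvg_lim => //; apply: cvgB; exact: cf.
  rewrite (_ : limn (fun n => `|h| * _) = `|h| * limn (series M)); last first.
    by apply: cvg_lim => //; apply: cvgM => //; exact: cvg_cst.
  move=> hle; rewrite normrZ normfV ler_pdivrMl ?normr_gt0//.
  apply: (le_trans hle); rewrite -mulrBr ler_wpM2l//.
  exact: ltW.
move: t2; rewrite scalerBr /= => t2.
set Q := h^-1 *: (S (h + x) - S x) in t2 *.
set Q' := h^-1 *: _ in t2 hP.
set d := limn _ in t1 *; set d' := series _ N in t1 hP.
have -> : d - Q = (d - d') + (d' - Q') - (Q - Q') by lra.
have := ler_normB ((d - d') + (d' - Q')) (Q - Q').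
have := ler_normD (d - d') (d' - Q'); lra.
Unshelve. all: by end_near. Qed.

(** Dominated convergence for series. *)
Lemma tannery {T : Type} (F : set_system T) {FF : Filter F}
    (f : nat -> T -> R) (g M : nat -> R) :
  (forall n, f n @ F --> g n) -> (forall n t, `|f n t| <= M n) ->
  (forall n, `|g n| <= M n) -> cvgn (series M) ->
  (fun t => limn (series (f^~ t))) @ F --> limn (series g).
Proof.
move=> fg fM gM cM; apply/cvgrPdist_lt => e e0.
have e3 : 0 < e / 4 by rewrite divr_gt0.
have [N tN] := series_tail_lt cM e3.
have cP : (fun y => series (f^~ y) N) @ F --> series g N.
  rewrite /series /= (_ : (fun y => _) = \sum_(0 <= k < N) f k); last first.
    by apply/funext => y; rewrite fct_sumE.
  apply: (big_ind2 (fun (h : T -> R) l => h @ F --> l)) => //.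
  - exact: cvg_cst.
  - by move=> *; exact: cvgD.
move/cvgrPdist_lt: cP => /(_ _ e3); apply: filterS => y hP.
have tx := le_lt_trans (@series_tail_le _ _ _ N gM cM) tN.
have ty := le_lt_trans (@series_tail_le _ _ _ N (fun n => fM n y) cM) tN.
set a := limn _ in tx *; set b := limn (series (f^~ y)) in ty *.
set a' := series _ N in tx hP; set b' := series _ N in ty hP.
have -> : a - b = (a - a') + (a' - b') - (b - b') by lra.
have := ler_normB ((a - a') + (a' - b')) (b - b').
have := ler_normD (a - a') (a' - b'); lra.
Qed.

(** The array [T j n] lists the [j]-th derivatives of the [n]-th term; one
    dominating series serves all orders. *)
Lemma Ck_circle_series k (T : nat -> nat -> R -> R) (M : nat -> R) :
  (forall j n (x : R), (j < k)%N -> is_derive x 1 (T j n) (T j.+1 n x)) ->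
  (forall n, continuous (T k n)) ->
  (forall j n x, (j <= k)%N -> `|T j n x| <= M n) ->
  (forall n, periodic (T 0%N n) 1) -> cvgn (series M) ->
  Ck_circle k (fun x => limn (series (fun n => T 0%N n x))).
Proof.
move=> dT cT TM pT cM; pose S j x := limn (series (fun n => T j n x)).
have dS j (x : R) : (j < k)%N -> is_derive x 1 (S j) (S j.+1 x).
  move=> jk; apply: (@is_derive_series (T j) (T j.+1) M).
  - by move=> n y; exact: dT.
  - by move=> n y; exact: TM.
  - exact: cM.
  - by move=> y; apply: dominated_series_cvg cM => n; apply: TM; exact: ltnW.
have dnS j : (j <= k)%N -> derive1n j (S 0%N) = S j.
  elim: j => [//|j IH] jk; rewrite derive1nS IH ?(ltnW jk)//.
  by apply/funext => x; rewrite derive1E; have [_ ->] := dS j x jk.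
split.
- by move=> x; congr (limn (series _)); apply/funext => n; exact: pT.
- by move=> j jk x; rewrite (dnS j (ltnW jk)); case: (dS j x jk) => d _; exact: d.
- rewrite dnS// => x; apply: (@tannery _ _ _ (T k) (T k ^~ x) M) => // n.
  + exact: cT.
  + by move=> y; exact: TM.
  + exact: TM.
Qed.

(** Evaluation inside the disc where the coefficients are absolutely bounded;
    at [h = 0] this bounds the function itself. *)
Lemma pseries_lim_le (c : nat -> R) (r M h l : R) : `|h| <= r ->
  (forall J, \sum_(0 <= j < J) `|c j| * r ^+ j <= M) ->
  pseries c h @ \oo --> l ->
  (forall J, `|pseries c h J| <= M) /\ `|l| <= M.
Proof.
move=> hr cM cl; have pM J : `|pseries c h J| <= M.
  apply: le_trans (cM J); rewrite /pseries /series /=.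
  apply: le_trans (ler_norm_sum _ _ _) _; apply: ler_sum => j _.
  rewrite normrM normrX ler_wpM2l// lerXn2r ?nnegrE//.
  exact: le_trans hr.
split=> //; have cn : `|pseries c h J| @[J --> \oo] --> `|l| by apply: cvg_norm.
rewrite -(cvg_lim (@Rhausdorff R) cn); apply: limr_le.
  by apply/cvg_ex; eexists; exact: cn.
by apply: nearW.
Qed.

(** Exchanging the two summations: the Taylor coefficients of the sum are the
    sums of the Taylor coefficients.  The radius is the same at every point. *)
Lemma analytic_circle_series (t : nat -> R -> R) (M : nat -> R)
    (a : R -> nat -> nat -> R) (r : R) :
  0 < r ->
  (forall n, periodic (t n) 1) ->
  (forall x n h, `|h| < r -> pseries (a x n) h @ \oo --> t n (x + h)) ->
  (forall x n J, \sum_(0 <= j < J) `|a x n j| * r ^+ j <= M n) ->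
  cvgn (series M) ->
  analytic_circle (fun x => limn (series (t^~ x))).
Proof.
move=> r0 pt at_ aM cM; split.
  by move=> x; congr (limn (series _)); apply/funext => n; exact: pt.
move=> x; pose c j := limn (series (fun n => a x n j)).
exists c, r; split => // h hr.
have rn0 j : r ^+ j != 0 by rewrite expf_neq0 ?gt_eqF.
have ca j : cvgn (series (fun n => a x n j)).
  apply: (@dominated_series_cvg _ _ (fun n => (r ^+ j)^-1 * M n)) => [n|].
    rewrite ler_pdivlMl ?exprn_gt0// mulrC; apply: le_trans (aM x n j.+1).
    by rewrite big_nat_recr//= lerDr sumr_ge0// => i _; rewrite mulr_ge0// exprn_ge0// ltW.
  exact: cvg_series_scale.
have pM n := pseries_lim_le (ltW hr) (aM x n) (at_ x n h hr).
rewrite (_ : pseries c h = fun J => limn (series (fun n => pseries (a x n) h J))).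
  apply: (@tannery _ _ _ (fun n J => pseries (a x n) h J) _ M) => // n.
  - exact: at_.
  - by move=> J; have [] := pM n.
  - by have [] := pM n.
apply/funext => J; apply/esym/cvg_lim => //.
rewrite (_ : series _ = \sum_(0 <= j < J) (fun N => series (fun n => a x n j) N * h ^+ j)); last first.
  apply/funext => N; rewrite fct_sumE /series /= exchange_big /=.
  by apply: eq_bigr => j _; rewrite mulr_suml.
apply: (big_ind2 (fun (u : nat -> R) l => u @ \oo --> l)) => [||j _].
- exact: cvg_cst.
- by move=> *; exact: cvgD.
- by apply: cvgM; [exact: ca | exact: cvg_cst].
Qed.

End termwise_differentiation.

(** * Birkhoff sums and coboundaries *)

Section coboundary.
Variable R : realType.
Implicit Types (alpha x : R) (m : int) (u : R -> R).

(** The sums are arranged so that the coboundary of [birkhoff alpha m u] is the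
    increment of [u] under translation by [- m alpha] for both signs of [m]. *)
Definition birkhoff alpha m u x : R :=
  if m is Posz k then \sum_(0 <= i < k) u (x - i.+1%:R * alpha)
  else - \sum_(0 <= i < `|m|%N) u (x + i%:R * alpha).

Lemma birkhoff_coboundary alpha m u x :
  birkhoff alpha m u x - birkhoff alpha m u (x + alpha) =
  u (x - m%:~R * alpha) - u x.
Proof.
case: m => k; rewrite /birkhoff.
  rewrite -sumrB; under eq_bigr => i _.
    rewrite (_ : x + alpha - i.+1%:R * alpha = x - i%:R * alpha); last first.
      by rewrite -natr1; ring.
    over.
  by rewrite (telescope_sumr (fun i => u (x - i%:R * alpha)))// mul0r subr0.
rewrite opprK addrC -sumrB; under eq_bigr => i _.
  rewrite (_ : x + alpha + i%:R * alpha = x + i.+1%:R * alpha); last first.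
    by rewrite -natr1; ring.
  over.
rewrite (telescope_sumr (fun i => u (x + i%:R * alpha)))// mul0r addr0.
by rewrite NegzE mulrNz mulNr opprK.
Qed.

(** One form for both signs of [m], so that the orbit estimates need no case
    distinction: the step [theta] is [alpha] up to sign. *)
Lemma norm_birkhoff_le alpha m : exists c theta : R,
  (forall k : nat, dist_int (k%:R * theta) = dist_int (k%:R * alpha)) /\
  forall u x, `|birkhoff alpha m u x| <=
    \sum_(0 <= i < `|m|%N) `|u (x + c + i%:R * theta)|.
Proof.
case: m => k.
  exists (- alpha), (- alpha); split => [j|u x]; first by rewrite mulrN dist_intN.
  apply: le_trans (ler_norm_sum _ _ _) _; apply: ler_sum => i _.
  by rewrite -natr1 (_ : x - _ = x - alpha + i%:R * - alpha)//; ring.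
exists 0, alpha; split => // u x.
by rewrite addr0 /birkhoff normrN; exact: ler_norm_sum.
Qed.

Lemma measurable_frac : measurable_fun [set: R] (@frac R).
Proof.
apply: measurable_funB => //; apply: nondecreasing_measurable => // x y xy.
by rewrite ler_int le_floor.
Qed.

Lemma measurable_shift u c : measurable_fun [set: R] u ->
  measurable_fun [set: R] (fun x => u (x + c)).
Proof.
by move=> mu; apply: measurableT_comp => //; exact: measurable_funD.
Qed.

Lemma measurable_birkhoff alpha m u c : measurable_fun [set: R] u ->
  measurable_fun [set: R] (fun x => birkhoff alpha m u (x + c)).
Proof.
move=> mu; case: m => k; rewrite /birkhoff.
  apply: measurable_sum => i; under eq_fun do rewrite -addrA.
  exact: measurable_shift.
apply: measurable_funN; apply: measurable_sum => i.
by under eq_fun do rewrite -addrA; exact: measurable_shift.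
Qed.

Lemma periodic_birkhoff alpha m u : periodic u 1 ->
  periodic (birkhoff alpha m u) 1.
Proof.
move=> pu x; case: m => k; rewrite /birkhoff; [|congr (- _)];
  by apply: eq_bigr => i _; rewrite addrAC pu.
Qed.

Definition sawtooth x : R := frac x - 1 / 2.

Lemma sawtooth_periodic : periodic sawtooth 1.
Proof. by move=> x; rewrite /sawtooth -[1]/(1%:~R) fracDz. Qed.

Lemma measurable_sawtooth : measurable_fun [set: R] sawtooth.
Proof. by apply: measurable_funB => //; exact: measurable_frac. Qed.

(** Convergence modulo 1 of the partial sums suffices because the sawtooth is
    continuous off the integers. *)
Lemma cvg_sawtooth (G : nat -> R) beta x : 0 < frac (x - beta) ->
  dist_int (G N - beta) @[N --> \oo] --> 0 ->
  sawtooth (x - G N) @[N --> \oo] --> sawtooth (x - beta).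
Proof.
move=> f0 dG; have /andP[_ f1] := frac_itv (x - beta).
apply: cvgB; last exact: cvg_cst.
apply/cvgrPdist_lt => e e0.
have d0 : 0 < Num.min e (Num.min (frac (x - beta)) (1 - frac (x - beta))).
  by rewrite !lt_min e0 f0 subr_gt0.
move/cvgrPdist_lt: dG => /(_ _ d0); apply: filterS => N /=.
rewrite sub0r normrN ger0_norm ?dist_int_ge0//.
have [m ->] := dist_intP (G N - beta); rewrite !lt_min => /and3P[h1 h2 h3].
set d := G N - beta - m%:~R in h1 h2 h3.
have /ltr_normlP[h2a h2b] := h2; have /ltr_normlP[h3a h3b] := h3.
rewrite (@frac_eq _ (frac (x - beta) - d) (x - G N) (Num.floor (x - beta) - m)).
  rewrite (@frac_id _ (frac (x - beta) - d)); last by apply/andP; split; lra.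
  by rewrite opprB addrCA subrr addr0.
by rewrite intrB /d /frac; lra.
Qed.

Lemma ae_frac_gt0 beta :
  {ae @lebesgue_measure R, forall x, 0 < frac (x - beta)}.
Proof.
have cD : countable (\bigcup_(m in [set: int]) [set beta + m%:~R]).
  by apply: bigcup_countable => // m _; exact: countable1.
exists (\bigcup_(m in [set: int]) [set beta + m%:~R]); split.
- by apply: countable_measurable => // t; exact: measurable_set1.
- exact: countable_lebesgue_measure0.
- move=> x /= /negP; have /andP[f0 _] := frac_itv (x - beta).
  rewrite -leNgt => fle; exists (Num.floor (x - beta)) => //=.
  have : frac (x - beta) = 0 by apply/eqP; rewrite eq_le fle.
  by rewrite /frac; lra.
Qed.

(** Telescoping: along the partial sums of [beta] the sawtooth defects add up
    to [phi beta], while each error [sawtooth - u n] is traded for its Birkhoff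
    sum, which is a coboundary.  The transfer function is the sum of these
    Birkhoff sums. *)
Lemma cohomologous_of_smoothing alpha beta (m : nat -> int) (G : nat -> R)
    (u : nat -> R -> R) (psi : R -> R) :
  G 0%N = 0 -> (forall n, G n.+1 = G n + (m n)%:~R * alpha) ->
  dist_int (G N - beta) @[N --> \oo] --> (0 : R) ->
  (forall n, periodic (u n) 1) -> (forall n, measurable_fun [set: R] (u n)) ->
  (forall x, series (fun n => u n (x - G n.+1) - u n (x - G n)) @ \oo --> psi x) ->
  {ae @lebesgue_measure R, forall x, cvgn (series (fun n =>
     birkhoff alpha (m n) (fun y => sawtooth y - u n y) (x - G n)))} ->
  additively_cohomologous alpha (phi beta) psi.
Proof.
move=> G0 GS dG pu mu cpsi cae.
pose F N x := series (fun n =>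
  birkhoff alpha (m n) (fun y => sawtooth y - u n y) (x - G n)) N.
have FT N x : F N x - F N (x + alpha) =
    sawtooth (x - G N) - sawtooth x
    - series (fun n => u n (x - G n.+1) - u n (x - G n)) N.
  rewrite /F /series /= -sumrB.
  rewrite (_ : sawtooth x = sawtooth (x - G 0%N)); last by rewrite G0 subr0.
  rewrite -(telescope_sumr (fun n => sawtooth (x - G n)))// -sumrB.
  apply: eq_bigr => n _; rewrite (addrAC x alpha) birkhoff_coboundary.
  rewrite (_ : x - G n - _ = x - G n.+1); last by rewrite GS; ring.
  by ring.
have mF N : measurable_fun [set: R] (F N).
  apply: measurable_sum => n; apply: measurable_birkhoff.
  by apply: measurable_funB => //; exact: measurable_sawtooth.
have pF N : periodic (F N) 1.
  move=> x; apply: eq_bigr => n _; rewrite addrAC periodic_birkhoff// => y.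
  by rewrite sawtooth_periodic pu.
(* the limit superior is measurable whether or not the series converges *)
pose f x := fine (limn_esup (fun N => (F N x)%:E)).
have fE x l : F N x @[N --> \oo] --> l -> f x = l.
  move=> cl; have cl' : (F N x)%:E @[N --> \oo] --> l%:E by apply: cvg_EFin => //; exact: nearW.
  by rewrite /f (cvg_limn_einf_sup cl').2.
exists f; split.
- by move=> x; rewrite /f; congr (fine (limn_esup _)); apply/funext => N; rewrite pF.
- apply: measurableT_comp; first exact: fine_measurable.
  by apply: measurable_fun_limn_esup => N; exact/measurable_EFinP.
- apply: (@filterS2 _ _ (ae_filter_ringOfSetsType _) _ _ _ _
    (ae_frac_gt0 beta) cae) => x fx /cvg_ex[l cl].
  have cl' : F N (x + alpha) @[N --> \oo] -->
      l - (sawtooth (x - beta) - sawtooth x - psi x).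
    rewrite (_ : (fun N => F N (x + alpha)) = (fun N => F N x -
      (sawtooth (x - G N) - sawtooth x
       - series (fun n => u n (x - G n.+1) - u n (x - G n)) N))); last first.
      by apply/funext => N; rewrite -FT; ring.
    apply: cvgB => //; apply: cvgB; last exact: cpsi.
    by apply: cvgB; [exact: cvg_sawtooth | exact: cvg_cst].
  by rewrite (fE _ _ cl) (fE _ _ cl') phiE /sawtooth; ring.
Qed.

End coboundary.

(** * Almost everywhere convergence of series of Birkhoff sums *)

Section measure_preserving.
Variable R : realType.
Local Notation mu := (@lebesgue_measure R).
Implicit Types U : R -> \bar R.

Lemma lebesgue_measure_translation (c : R) (A : set R) : measurable A ->
  pushforward mu ((fun x => x + c) : _ -> measurableTypeR R) A = mu A.
Proof.
move=> mA; apply/esym.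
have mc : measurable_fun [set: R] (fun x : R => x + c).
  exact: measurable_funD.
pose nu := pushforward mu ((fun x => x + c) : _ -> measurableTypeR R).
apply: (@lebesgue_measure_unique _ nu) => //= _ [[a b]] _ <-.
rewrite /nu /pushforward.
have -> : (fun x => x + c) @^-1` `]a, b]%classic = `](a - c), (b - c)]%classic.
  by apply/seteqP; split => x /=; rewrite !in_itv /= ltrBlDr lerBrDr.
rewrite /= !lebesgue_measure_itv/= !lte_fin ltrD2r.
by case: ifP => // _; rewrite -!EFinB opprB addrA subrK.
Qed.

Lemma integral_translation (c : R) U :
  measurable_fun [set: R] U -> (forall x, (0 <= U x)%E) ->
  (\int[mu]_x U (x + c)%R = \int[mu]_x U x)%E.
Proof.
move=> mU U0; have mc : measurable_fun [set: R] (fun x : R => x + c).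
  exact: measurable_funD.
rewrite -[LHS](@ge0_integral_pushforward _ _ (measurableTypeR R) (measurableTypeR R) R
  ((fun x => x + c) : _ -> measurableTypeR R) mc mu setT U)//=.
by apply: eq_measure_integral => A mA _; exact: lebesgue_measure_translation.
Qed.

Lemma integral_reflection U :
  measurable_fun [set: R] U -> (forall x, (0 <= U x)%E) ->
  (\int[mu]_x U (- x)%R = \int[mu]_x U x)%E.
Proof.
move=> mU U0.
rewrite -[LHS](@ge0_integral_pushforward _ _ (measurableTypeR R) (measurableTypeR R) R
  (-%R : _ -> measurableTypeR R) _ mu setT U)//=.
by apply: eq_measure_integral => A mA _; exact: lebesgue_measureN.
Qed.

Definition near0 (w t : R) : R := \1_(`](- w), w[%classic) t.

Lemma near0_ge0 w t : 0 <= near0 w t.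
Proof. by rewrite /near0 indicE. Qed.

Lemma near0E w t : `|t| < w -> near0 w t = 1.
Proof. by move=> tw; rewrite /near0 indicE mem_set//= in_itv /= -ltr_norml. Qed.

Lemma measurable_near0 w : measurable_fun [set: R] (near0 w).
Proof. by apply: measurable_indic; exact: measurable_itv. Qed.

Lemma integral_near0 w : 0 <= w -> (\int[mu]_t (near0 w t)%:E = (2 * w)%:E)%E.
Proof.
move=> w0; rewrite integral_indic ?setIT//.
  rewrite [LHS]lebesgue_measure_itv /= lte_fin.
  case: ifPn => [_|]; first by rewrite -EFinB opprK; congr EFin; ring.
  by rewrite -leNgt => h; congr EFin; lra.
Qed.

(** The maximum equals [t] wherever the indicator is 1; with it the factor is
    monotone on the whole line, hence measurable. *)
Definition half_tail (delta A t : R) : R :=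
  \1_(`[delta, +oo[%classic) t * (A / Num.max delta t ^+ 2).

Definition tail0 (delta A t : R) : R :=
  half_tail delta A t + half_tail delta A (- t).

Lemma half_tail_ge0 delta A t : 0 <= A -> 0 <= half_tail delta A t.
Proof.
by move=> A0; rewrite /half_tail indicE mulr_ge0// divr_ge0// sqr_ge0.
Qed.

Lemma tail0_ge0 delta A t : 0 <= A -> 0 <= tail0 delta A t.
Proof. by move=> A0; rewrite addr_ge0// half_tail_ge0. Qed.

Lemma half_tailE delta A t : delta <= t -> half_tail delta A t = A / t ^+ 2.
Proof.
move=> dt; rewrite /half_tail indicE mem_set; last by rewrite /= in_itv /= dt.
by rewrite mul1r max_r.
Qed.

Lemma tail0_ge delta A t : 0 <= A -> delta <= `|t| ->
  A / t ^+ 2 <= tail0 delta A t.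
Proof.
move=> A0; have [t0 dt|t0 dt] := ger0P t.
  by rewrite /tail0 (half_tailE _ dt) lerDl half_tail_ge0.
by rewrite /tail0 (half_tailE _ dt) sqrrN lerDr half_tail_ge0.
Qed.

Lemma measurable_half_tail delta A : 0 < delta -> 0 <= A ->
  measurable_fun [set: R] (half_tail delta A).
Proof.
move=> d0 A0; apply: measurable_funM.
  by apply: measurable_indic; exact: measurable_itv.
apply: nonincreasing_measurable => // x y xy.
have mx z : 0 < Num.max delta z by rewrite lt_max d0.
rewrite ler_wpM2l// lef_pV2 ?posrE ?exprn_gt0// lerXn2r ?nnegrE ?(ltW (mx _))//.
by rewrite ge_max !le_max lexx xy orbT.
Qed.

Lemma measurable_tail0 delta A : 0 < delta -> 0 <= A ->
  measurable_fun [set: R] (tail0 delta A).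
Proof.
move=> d0 A0; apply: measurable_funD; first exact: measurable_half_tail.
by apply: measurableT_comp => //; exact: measurable_half_tail.
Qed.

Lemma is_derive_inv (x : R) : x != 0 ->
  is_derive x 1 (fun t : R => t^-1) (- x ^- 2).
Proof.
move=> x0; apply: DeriveDef; first exact: derivableV.
by rewrite deriveV// derive_id /GRing.scale /= mulr1.
Qed.

Lemma integral_half_tail delta A : 0 < delta -> 0 <= A ->
  (\int[mu]_t (half_tail delta A t)%:E = (A / delta)%:E)%E.
Proof.
move=> d0 A0.
transitivity (\int[mu]_(t in `[delta, +oo[) (A / t ^+ 2)%:E)%E.
  rewrite [RHS]integral_mkcond; apply: eq_integral => t _.
  rewrite /patch; case: ifPn => [|tn].
    by rewrite inE /= in_itv /= andbT => /half_tailE ->.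
  by rewrite /half_tail indicE (negbTE tn) mul0r.
rewrite (@ge0_continuous_FTC2y _ _ (fun t => - (A / t)) _ 0).
- by rewrite -EFinB; congr EFin; rewrite opprK add0r.
- by move=> x _; rewrite divr_ge0// sqr_ge0.
- apply: continuous_in_subspaceT => x; rewrite inE /= in_itv /= andbT => dx.
  apply: cvgM; first exact: cvg_cst.
  apply: cvgV; last exact: exprn_continuous.
  by rewrite expf_neq0// gt_eqF// (lt_le_trans d0).
- rewrite -oppr0; apply: cvgN; rewrite -(mulr0 A).
  apply: cvgM; first exact: cvg_cst.
  apply/gtr0_cvgV0; last exact: cvg_id.
  by exists 0; split.
- move=> x dx; apply: derivableN; apply: derivableM => //.
  by apply: derivableV => //; rewrite gt_eqF// (lt_trans d0).
- apply: cvg_at_right_filter; apply: cvgN; apply: cvgM; first exact: cvg_cst.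
  by apply: cvgV; rewrite ?gt_eqF.
- move=> x; rewrite in_itv /= andbT => dx.
  have x0 : x != 0 by rewrite gt_eqF// (lt_trans d0).
  have dV := is_derive_inv x0.
  rewrite derive1E (_ : (fun t => _) = - (A *: (fun t : R => t^-1)))//.
  by rewrite derive_val /GRing.scale /= mulrN opprK.
Qed.

Lemma integral_tail0 delta A : 0 < delta -> 0 <= A ->
  (\int[mu]_t (tail0 delta A t)%:E = (2 * (A / delta))%:E)%E.
Proof.
move=> d0 A0; rewrite /tail0; under eq_integral do rewrite EFinD.
have mh := measurable_half_tail d0 A0.
rewrite ge0_integralD//; last 4 first.
- by move=> x _; rewrite lee_fin half_tail_ge0.
- exact/measurable_EFinP.
- by move=> x _; rewrite lee_fin half_tail_ge0.
- by apply/measurable_EFinP; apply: measurableT_comp.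
rewrite (integral_reflection (U := fun t => (half_tail delta A t)%:E)).
- by rewrite integral_half_tail// -EFinD; congr EFin; ring.
- exact/measurable_EFinP.
- by move=> x; rewrite lee_fin half_tail_ge0.
Qed.

End measure_preserving.

Section almost_everywhere_convergence.
Variable R : realType.
Local Notation mu := (@lebesgue_measure R).

Lemma measurable_double_translates (U : R -> R) (n S : nat) (a : nat -> nat -> R) :
  measurable_fun [set: R] U ->
  measurable_fun [set: R]
    (fun x => \sum_(0 <= i < n) \sum_(0 <= s < S) U (x + a i s)).
Proof.
move=> mU; apply: measurable_sum => i; apply: measurable_sum => s.
exact: measurable_shift.
Qed.

Lemma integral_double_translates (U : R -> R) (I : R) (n S : nat)
    (a : nat -> nat -> R) :
  measurable_fun [set: R] U -> (forall x, 0 <= U x) ->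
  (\int[mu]_x (U x)%:E = I%:E)%E ->
  (\int[mu]_x (\sum_(0 <= i < n) \sum_(0 <= s < S) U (x + a i s)%R)%R%:E
    = ((n * S)%:R * I)%:E)%E.
Proof.
move=> mU U0 UI.
have mUs c : measurable_fun [set: R] (fun x => (U (x + c))%:E).
  by apply/measurable_EFinP; exact: measurable_shift.
have IU c : (\int[mu]_x (U (x + c)%R)%:E = I%:E)%E.
  rewrite -UI (integral_translation c (U := fun x => (U x)%:E))//.
  exact/measurable_EFinP.
have E x : (\sum_(0 <= i < n) \sum_(0 <= s < S) U (x + a i s)%R)%:E =
    (\sum_(0 <= i < n) \sum_(0 <= s < S) (U (x + a i s)%R)%:E)%E.
  by rewrite -sumEFin; apply: eq_bigr => i _; rewrite -sumEFin.
under eq_integral do rewrite E.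
rewrite ge0_integral_sum//; last 2 first.
- by move=> i; apply: emeasurable_sum => s; exact: mUs.
- by move=> i x _; apply: sume_ge0 => s _; rewrite lee_fin.
have Ei i : (\int[mu]_x (\sum_(0 <= s < S) (U (x + a i s)%R)%:E) =
    (I *+ S)%:E)%E.
  rewrite ge0_integral_sum//; last 2 first.
  - by move=> s; exact: mUs.
  - by move=> s x _; rewrite lee_fin.
  by rewrite (eq_bigr (fun=> I%:E)) ?sumEFin ?sumr_const_nat ?subn0.
rewrite (eq_bigr (fun=> (I *+ S)%:E))//.
rewrite sumEFin sumr_const_nat subn0; congr EFin.
by rewrite -mulrnA mulnC mulr_natl.
Qed.

(** If one of the first [q] points of the orbit comes within
    [w = delta + |b| ||q alpha||] of an integer, the first sum is at least 1.
    Otherwise all [|b| q] points stay at distance [delta], since [q] steps move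
    a point by [||q alpha||] only, and the second sum dominates. *)
Lemma birkhoff_majorant (alpha g delta A : R) (b : int) (q N : nat)
    (e : R -> R) : 0 < delta -> 0 <= A ->
  (forall y, delta <= dist_int y -> `|e y| <= A / dist_int y ^+ 2) ->
  exists a : nat -> nat -> R, forall x, `|x| <= N%:R ->
    let w := delta + `|b%:~R| * dist_int (q%:R * alpha) in
    let V := \sum_(0 <= r < q) \sum_(0 <= s < N.+1.*2) near0 w (x + a r s)
      + \sum_(0 <= i < `|b| * q) \sum_(0 <= s < N.+1.*2)
          tail0 delta A (x + a i s) in
    1 <= V \/ `|birkhoff alpha (b * q%:Z) e (x - g)| <= V.
Proof.
move=> d0 A0 He.
have [c [th [dth Hb]]] := norm_birkhoff_le alpha (b * q%:Z).
pose z i : R := - g + c + i%:R * th.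
pose k0 i : int := Num.floor (z i - N%:R).
exists (fun i s => z i - (k0 i)%:~R - s%:R) => x xN w V.
have xz i : x - g + c + i%:R * th = x + z i by rewrite /z; ring.
(* the integer nearest to the i-th point is one of those in the range of s *)
have cover (U : R -> R) i : (forall t, 0 <= U t) -> exists t : R,
    [/\ dist_int (x + z i) = `|t| &
     U t <= \sum_(0 <= s < N.+1.*2) U (x + (z i - (k0 i)%:~R - s%:R))].
  move=> U0; have [k dk] := dist_intP (x + z i).
  have := dist_int_le_half (x + z i); rewrite dk => /ler_normlP[k1 k2].
  have /ler_normlP[x1 x2] := xN.
  have /andP[f1 f2] := floor_itv (z i - N%:R).
  rewrite intrD -/(k0 i) in f1 f2.
  have : ((k0 i)%:~R - 1 < k%:~R :> R) by lra.
  rewrite -[1]/(1%:~R) -intrB ltr_int => l1.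
  have : (k%:~R < (k0 i)%:~R + (2 * N%:R + 2)%R :> R) by lra.
  rewrite (_ : 2 * N%:R + 2 = (N.+1.*2)%:Z%:~R :> R); last first.
    by rewrite -pmulrn -muln2 natrM -natr1; ring.
  rewrite -intrD ltr_int => l2.
  exists (x + z i - k%:~R); split => //.
  have [s [sk sN]] : exists s : nat, k = k0 i + s%:Z /\ (s < N.+1.*2)%N.
    by exists `|k - k0 i|%N; clear -l1 l2; split; lia.
  rewrite (bigD1_seq s) ?iota_uniq ?mem_index_iota ?sN//=.
  rewrite (_ : x + (z i - (k0 i)%:~R - s%:R) = x + z i - k%:~R); last first.
    by rewrite sk intrD; ring.
  by rewrite lerDl sumr_ge0.
have V1 : 0 <= \sum_(0 <= r < q) \sum_(0 <= s < N.+1.*2)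
    near0 w (x + (z r - (k0 r)%:~R - s%:R)).
  by apply: sumr_ge0 => r _; apply: sumr_ge0 => s _; exact: near0_ge0.
have V2 : 0 <= \sum_(0 <= i < `|b| * q) \sum_(0 <= s < N.+1.*2)
    tail0 delta A (x + (z i - (k0 i)%:~R - s%:R)).
  by apply: sumr_ge0 => r _; apply: sumr_ge0 => s _; exact: tail0_ge0.
have [[r [rq rw]]|far] := pselect (exists r, (r < q)%N /\ dist_int (x + z r) < w).
  left; rewrite /V; apply: ler_wpDr => //.
  rewrite (bigD1_seq r) ?iota_uniq ?mem_index_iota ?rq//=.
  have [t [dt Ut]] := cover (near0 w) r (near0_ge0 w).
  rewrite dt in rw; rewrite near0E// in Ut.
  apply: (le_trans Ut); rewrite lerDl.
  by apply: sumr_ge0 => j _; apply: sumr_ge0 => s _; exact: near0_ge0.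
right; apply: (le_trans (Hb e (x - g))); rewrite abszM /=.
rewrite /V; apply: ler_wpDl => //.
rewrite big_nat [leRHS]big_nat; apply: ler_sum => i /= ib; rewrite xz.
have [t [dt Ut]] := cover (tail0 delta A) i (fun t => tail0_ge0 delta t A0).
suff di : delta <= dist_int (x + z i).
  apply: le_trans (He _ di) _; apply: le_trans Ut.
  by rewrite dt real_normK ?num_real// tail0_ge// -dt.
have q0 : (0 < q)%N by case: (q) ib; rewrite ?muln0.
have rq : (i %% q < q)%N by rewrite ltn_mod.
have wr : w <= dist_int (x + z (i %% q)%N).
  by rewrite leNgt; apply/negP => h; apply: far; exists (i %% q)%N.
have E : x + z (i %% q)%N = x + z i + - ((i %/ q)%:R * (q%:R * th)).
  by rewrite {2}(divn_eq i q) /z natrD natrM; ring.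
have h1 := dist_intD (x + z i) (- ((i %/ q)%:R * (q%:R * th))).
have h2 := dist_intMn (q%:R * th) (i %/ q).
rewrite -E dist_intN in h1; rewrite dth in h2.
have h3 : (i %/ q)%:R * dist_int (q%:R * alpha) <= `|b%:~R| * dist_int (q%:R * alpha).
  rewrite ler_wpM2r ?dist_int_ge0//.
  rewrite -intr_norm -abszE ler_nat ltnW// ltn_divLR//.
rewrite /w in wr; lra.
Qed.

(** The majorants have summable integrals over the line, so their sum is almost
    everywhere finite.  In particular they tend to 0, which excludes for large
    [n] the alternative where the majorant is at least 1: this does the work of
    the Borel-Cantelli lemma.  Bounding the tail of the errors by an integral,
    not by a supremum, avoids a loss of a factor [q]. *)
Lemma ae_cvg_birkhoff (alpha : R) (b : nat -> int) (q : nat -> nat)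
    (e : nat -> R -> R) (delta A tau g : nat -> R) :
  (forall n, 0 < delta n) -> (forall n, 0 <= A n) ->
  (forall n y, delta n <= dist_int y -> `|e n y| <= A n / dist_int y ^+ 2) ->
  (forall n, (q n)%:R * (delta n + `|(b n)%:~R| * dist_int ((q n)%:R * alpha))
     + `|(b n)%:~R| * (q n)%:R * (A n / delta n) <= tau n) ->
  cvgn (series tau) ->
  {ae mu, forall x, cvgn (series (fun n =>
     birkhoff alpha (b n * (q n)%:Z) (e n) (x - g n)))}.
Proof.
move=> d0 A0 He Htau ctau.
suff H (N : nat) : {ae mu, forall x, `|x| <= N%:R -> cvgn (series (fun n =>
     birkhoff alpha (b n * (q n)%:Z) (e n) (x - g n)))}.
  move/ae_foralln : H; apply: filterS => x Hx; apply: (Hx (Num.truncn `|x|).+1).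
  by have := truncnS_gt `|x|; exact: ltW.
pose S := N.+1.*2.
have /choice[a Ha] := fun n =>
  birkhoff_majorant alpha (g n) (b n) (q n) N (d0 n) (A0 n) (He n).
pose w n := delta n + `|(b n)%:~R| * dist_int ((q n)%:R * alpha).
have w0 n : 0 <= w n by rewrite addr_ge0 ?mulr_ge0 ?dist_int_ge0// ltW.
pose V n x := \sum_(0 <= r < q n) \sum_(0 <= s < S) near0 (w n) (x + a n r s)
      + \sum_(0 <= i < `|b n| * q n) \sum_(0 <= s < S)
          tail0 (delta n) (A n) (x + a n i s).
have V0 n x : 0 <= V n x.
  by rewrite addr_ge0// ?sumr_ge0// => i _; apply: sumr_ge0 => s _;
    [exact: near0_ge0 | exact: tail0_ge0].
have mV1 n := measurable_double_translates (q n) S (a n) (measurable_near0 (w n)).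
have mV2 n := measurable_double_translates (`|b n| * q n) S (a n)
  (measurable_tail0 (d0 n) (A0 n)).
have mV n : measurable_fun [set: R] (fun x => (V n x)%:E).
  by apply/measurable_EFinP; exact: measurable_funD.
have tau0 n : 0 <= tau n.
  apply: le_trans (Htau n).
  by rewrite addr_ge0 ?mulr_ge0 ?invr_ge0 ?w0// ltW.
have IV n : (\int[mu]_x (V n x)%:E <= ((2 * S%:R) * tau n)%:E)%E.
  under eq_integral do rewrite EFinD.
  rewrite ge0_integralD//; last 4 first.
  - move=> x _; rewrite lee_fin; apply: sumr_ge0 => i _; apply: sumr_ge0 => s _.
    exact: near0_ge0.
  - by apply/measurable_EFinP; apply: mV1.
  - move=> x _; rewrite lee_fin; apply: sumr_ge0 => i _; apply: sumr_ge0 => s _.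
    exact: tail0_ge0.
  - by apply/measurable_EFinP; apply: mV2.
  rewrite (integral_double_translates _ _ _ (measurable_near0 _) (near0_ge0 _) (integral_near0 (w0 n))).
  rewrite (integral_double_translates _ _ _ (measurable_tail0 (d0 n) (A0 n))
    (fun t => tail0_ge0 _ t (A0 n)) (integral_tail0 (d0 n) (A0 n))).
  rewrite -EFinD lee_fin !natrM natr_absz intr_norm.
  apply: le_trans (ler_wpM2l _ (Htau n)); last by rewrite mulr_ge0.
  by rewrite le_eqVlt; apply/orP; left; apply/eqP; rewrite -/(w n); ring.
have IS : (\int[mu]_x (\sum_(n <oo) (V n x)%:E) < +oo)%E.
  rewrite integral_nneseries//; last by move=> n x _; rewrite lee_fin.
  have c2 := @cvg_series_scale _ _ (2 * S%:R) ctau.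
  apply: (@le_lt_trans _ _ (\sum_(n <oo) ((2 * S%:R) * tau n)%:E)%E).
    apply: lee_nneseries => n _; last exact: IV.
    by move=> _; apply: integral_ge0 => x _; rewrite lee_fin.
  rewrite (_ : (\sum_(n <oo) _)%E = (limn (series (fun n => 2 * S%:R * tau n)))%:E).
    exact: ltry.
  apply/cvg_lim => //.
  rewrite (_ : (fun n => _) = EFin \o series (fun n => 2 * S%:R * tau n)).
    by apply: cvg_EFin => //; exact: nearW.
  by apply/funext => n /=; rewrite sumEFin.
have iS : mu.-integrable [set: R] (fun x => (\sum_(n <oo) (V n x)%:E)%E).
  apply/integrableP; split.
    apply: (@ge0_emeasurable_sum _ _ _ _ (fun n x => (V n x)%:E) xpredT).
      by move=> n x _ _; rewrite lee_fin.
    by move=> n _; exact: mV.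
  under eq_integral => x _.
    rewrite gee0_abs; last by apply: nneseries_ge0 => n _ _; rewrite lee_fin.
    over.
  exact: IS.
have := integrable_ae measurableT iS; apply: filterS => x /(_ I) fx xN.
have cV : cvgn (series (fun n => V n x)).
  by apply: nnseries_is_cvg => //; rewrite ltey_eq fx.
have [M _ HM] : \forall n \near \oo, V n x < 1.
  have := cvg_series_cvg_0 cV; move/cvgrPdist_lt => /(_ 1 ltr01).
  by apply: filterS => n; rewrite sub0r normrN => /ltr_normlW.
apply: (@cvg_series_eventually _ (fun n => if (n < M)%N then 0 else
     birkhoff alpha (b n * (q n)%:Z) (e n) (x - g n)) _ M).
  by move=> n Mn; rewrite ltnNge Mn.
apply: dominated_series_cvg cV => n; case: ltnP => Mn; first by rewrite normr0.
have [|//] := Ha n x xN; rewrite -/S -/(w n) -/(V n x).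
by rewrite leNgt HM.
Qed.

End almost_everywhere_convergence.

(** * Bernoulli functions on the circle *)

Section bernoulli.
Variable R : realType.
Implicit Types (p q : {poly R}) (x y h : R).

Definition primitive p : {poly R} :=
  \poly_(i < (size p).+1) (p`_i.-1 / i%:R).

Lemma deriv_primitive p : (primitive p)^`() = p.
Proof.
apply/polyP => i; rewrite coef_deriv coef_poly ltnS.
case: ltnP => [_|le]; last by rewrite mul0rn nth_default.
by rewrite -[LHS]mulr_natr divfK// pnatr_eq0.
Qed.

Lemma primitive0 p : (primitive p).[0] = 0.
Proof. by rewrite horner_coef0 coef_poly /= invr0 mulr0. Qed.

Lemma deriv_eq0 p : p^`() = 0 -> p = (p`_0)%:P.
Proof.
move=> p0; apply/polyP => -[|i]; rewrite coefC//=.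
have := congr1 (fun q : {poly R} => q`_i) p0; rewrite coef_deriv coef0.
by move/eqP; rewrite -mulr_natr mulf_eq0 pnatr_eq0 orbF => /eqP.
Qed.

Lemma deriv_increment p q : p^`() = q^`() -> p.[1] - p.[0] = q.[1] - q.[0].
Proof.
move=> pq; have /deriv_eq0 E : (p - q)^`() = 0 by rewrite derivB pq subrr.
have E1 := congr1 (fun r : {poly R} => r.[1]) E.
have E0 := congr1 (fun r : {poly R} => r.[0]) E.
move: E1 E0; rewrite !hornerE; lra.
Qed.

(** The Bernoulli polynomials divided by factorials, shifted by one in degree:
    [bernoulli i] has degree [i + 1].  The constant of integration makes the
    mean over [0, 1] vanish, so that the next one is continuous on the circle. *)
Fixpoint bernoulli (i : nat) : {poly R} :=
  if i is j.+1 then primitive (bernoulli j) - (primitive (primitive (bernoulli j))).[1]%:P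
  else 'X - (1 / 2)%:P.

Lemma deriv_bernoulli i : (bernoulli i.+1)^`() = bernoulli i.
Proof. by rewrite /= derivB derivC subr0 deriv_primitive. Qed.

(** The integral over [0, 1] is the increment of any primitive; explicit
    primitives with equal end values are at hand at each step. *)
Lemma bernoulli_mean0 i : (primitive (bernoulli i)).[1] = 0.
Proof.
have inc q : q^`() = bernoulli i -> q.[1] = q.[0] ->
    (primitive (bernoulli i)).[1] = 0.
  move=> dq q10; have := @deriv_increment (primitive (bernoulli i)) q.
  by rewrite deriv_primitive dq => /(_ erefl); rewrite primitive0 q10; lra.
case: i inc => [|i] inc.
  apply: (inc (2^-1 *: ('X ^+ 2 - 'X))).
    rewrite derivZ derivB derivXn derivX /= expr1 scalerBr -['X *+ 2]scaler_nat scalerA.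
    by rewrite mulVf ?pnatr_eq0// scale1r alg_polyC mul1r.
  by rewrite !hornerE; ring.
set c := (primitive (primitive (bernoulli i))).[1].
apply: (inc (primitive (primitive (bernoulli i)) - c *: 'X)).
  by rewrite derivB deriv_primitive derivZ derivX alg_polyC.
by rewrite !hornerE primitive0 -/c; ring.
Qed.

Lemma bernoulli_closes i : (bernoulli i.+1).[1] = (bernoulli i.+1).[0].
Proof. by rewrite /= !hornerE primitive0 bernoulli_mean0. Qed.

Definition circle_poly p x : R := p.[frac x].

Lemma circle_poly_periodic p : periodic (circle_poly p) 1.
Proof. by move=> x; rewrite /circle_poly -[1]/(1%:~R) fracDz. Qed.

Lemma horner_bounded p : exists2 C, 0 <= C &
  forall t, 0 <= t <= 1 -> `|p.[t]| <= C.
Proof.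
exists (\sum_(i < size p) `|p`_i|); first by apply: sumr_ge0.
move=> t /andP[t0 t1]; rewrite horner_coef.
apply: le_trans (ler_norm_sum _ _ _) _; apply: ler_sum => i _.
rewrite normrM ler_piMr// normrX ger0_norm//.
exact: exprn_ile1.
Qed.

(** A path crossing an integer leaves through the value at 1 and re-enters
    through the equal value at 0. *)
Lemma circle_poly_lipschitz p : p.[1] = p.[0] -> exists2 C, 0 <= C &
  forall x gamma, `|circle_poly p (x - gamma) - circle_poly p x| <= C * dist_int gamma.
Proof.
move=> p10; have [C C0 HC] := horner_bounded p^`(); exists C => //.
have lip s t : 0 <= s -> s <= t -> t <= 1 -> `|p.[t] - p.[s]| <= C * (t - s).
  move=> s0 st t1.
  have cp : {within `[s, t], continuous (horner p)}.
    by apply: continuous_subspaceT => z; exact: continuous_horner.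
  have [c] := MVT_segment st (fun z _ => is_derive_poly p z) cp.
  rewrite in_itv /= => /andP[sc ct] ->; rewrite normrM (ger0_norm (_ : 0 <= t - s)) ?subr_ge0//.
  by rewrite ler_wpM2r ?subr_ge0// HC// (le_trans s0 sc) (le_trans ct).
have lipR x y : x <= y -> `|circle_poly p y - circle_poly p x| <= C * (y - x).
  move=> xy; rewrite /circle_poly.
  have /andP[x0 x1] := frac_itv x; have /andP[y0 y1] := frac_itv y.
  have := le_floor xy; rewrite le_eqVlt => /orP[/eqP e|lt].
    have -> : y - x = frac y - frac x by rewrite /frac e; ring.
    by apply: lip => //; [rewrite /frac e; lra | exact: ltW].
  have : (Num.floor x)%:~R + 1 <= (Num.floor y)%:~R :> R.
    by rewrite -[1]/(1%:~R) -intrD ler_int; lia.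
  move=> fxy; have h1 := lip _ _ (lexx 0) y0 (ltW y1).
  have h2 := lip _ _ x0 (ltW x1) (lexx 1).
  have -> : p.[frac y] - p.[frac x] = (p.[frac y] - p.[0]) + (p.[1] - p.[frac x]).
    by rewrite p10; ring.
  apply: le_trans (ler_normD _ _) _.
  apply: (@le_trans _ _ (C * (frac y + (1 - frac x)))); first lra.
  by rewrite ler_wpM2l// /frac; lra.
move=> x gamma; have [m dm] := dist_intP gamma.
rewrite dm -(@periodic_int _ _ (x - gamma) m (circle_poly_periodic p)).
set y := x - gamma + _; have [yx|xy] := leP y x.
  rewrite distrC; apply: le_trans (lipR _ _ yx) _.
  by rewrite ler_wpM2l// (le_trans _ (ler_norm _))// /y; lra.
apply: le_trans (lipR _ _ (ltW xy)) _.
by rewrite ler_wpM2l// -normrN (le_trans _ (ler_norm _))// /y; lra.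
Qed.

Lemma is_derive_horner_shift p (a x : R) :
  is_derive x 1 (fun y : R => p.[y + a]) p^`().[x + a].
Proof.
have -> : (fun y : R => p.[y + a]) = horner (p \Po ('X + a%:P)).
  by apply/funext => y; rewrite horner_comp !hornerE.
have -> : p^`().[x + a] = (p \Po ('X + a%:P))^`().[x].
  by rewrite deriv_comp derivD derivX derivC addr0 mulr1 horner_comp !hornerE.
exact: is_derive_poly.
Qed.

(** At an integer the difference quotients from the right are those of [p] at 0
    and from the left those of [p] at 1. *)
Lemma is_derive_circle_poly p x : p.[1] = p.[0] -> p^`().[1] = p^`().[0] ->
  is_derive x 1 (circle_poly p) (circle_poly p^`() x).
Proof.
move=> p10 dp10; set m := Num.floor x; have /andP[fx0 fx1] := frac_itv x.
have eqR y : m%:~R <= y < m%:~R + 1 -> circle_poly p y = p.[y + (- m%:~R)].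
  move=> /andP[y1 y2]; rewrite /circle_poly /frac (@floor_def _ y m)//.
  by rewrite intrD y1.
have [fx|fx] := eqVneq (frac x) 0; last first.
  have -> : circle_poly p^`() x = p^`().[x + (- m%:~R)] by [].
  apply: (@near_eq_is_derive _ _ _ (fun y : R => p.[y + (- m%:~R)])); last first.
    exact: is_derive_horner_shift.
  have f0 : 0 < frac x by rewrite lt_neqAle eq_sym fx.
  have : x \in `]m%:~R, (m%:~R + 1)[.
    by rewrite in_itv /=; move: f0 fx1; rewrite /frac -/m; lra.
  move=> /near_in_itvoo; apply: filterS => y; rewrite in_itv /= => /andP[y1 y2].
  by rewrite eqR// (ltW y1).
have xm : x = m%:~R by move: fx; rewrite /frac -/m; lra.
have eqL y : m%:~R - 1 <= y < m%:~R -> circle_poly p y = p.[y + (1 - m%:~R)].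
  move=> /andP[y1 y2]; rewrite /circle_poly /frac (@floor_def _ y (m - 1)).
    by rewrite intrB opprB.
  by rewrite subrK intrB y1.
have cx : circle_poly p x = p.[0] by rewrite /circle_poly fx.
have dR := is_derive_horner_shift p (- m%:~R) x.
have dL := is_derive_horner_shift p (1 - m%:~R) x.
rewrite -xm subrr in dR; rewrite -xm addrCA subrr addr0 dp10 in dL.
have quot a : is_derive x 1 (fun y : R => p.[y + a]) p^`().[0] ->
    (fun h => h^-1 *: (p.[h + x + a] - p.[x + a])) @ 0^' --> p^`().[0].
  case=> /cvg_ex[l cl] <-; rewrite /derive (cvg_lim _ cl)//.
  by move: cl; under eq_fun do rewrite /= /GRing.scale /= mulr1.
suff cS : (fun h => h^-1 *: (circle_poly p (h + x) - circle_poly p x)) @ 0^'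
    --> p^`().[0].
  have e0 : (fun h : R => h^-1 *: ((circle_poly p \o shift x) h%:A - circle_poly p x)) =
    (fun h => h^-1 *: (circle_poly p (h + x) - circle_poly p x)).
    by apply/funext => h /=; rewrite /GRing.scale /= mulr1.
  have -> : circle_poly p^`() x = p^`().[0] by rewrite /circle_poly fx.
  apply: DeriveDef; first by rewrite /derivable e0; apply/cvg_ex; eexists; exact: cS.
  by rewrite /derive e0; exact/cvg_lim.
apply/cvgrPdist_lt => e e0.
have /cvgrPdist_lt/(_ _ e0) nR := quot _ dR.
have /cvgrPdist_lt/(_ _ e0) nL := quot _ dL.
near=> h.
have h1 : `|h| < 1.
  by near: h; exact: dnbhs0_lt.
have /ltr_normlP[h1a h1b] := h1.
have [h0|h0] := leP 0 h.
  have -> : circle_poly p (h + x) = p.[h + x + (- x)].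
    by rewrite xm eqR//; apply/andP; split; lra.
  have -> : circle_poly p x = p.[x + (- x)] by rewrite cx subrr.
  by near: h.
have -> : circle_poly p (h + x) = p.[h + x + (1 - x)].
  by rewrite xm eqL//; apply/andP; split; lra.
have -> : circle_poly p x = p.[x + (1 - x)] by rewrite cx addrCA subrr addr0.
by near: h.
Unshelve. all: by end_near. Qed.

End bernoulli.

(** * Smoothing the sawtooth by averaging *)

Section box_smoothing.
Variable R : realType.
Implicit Types (g : R -> R) (p : {poly R}) (x h : R).

(** Up to the factor [2 h], the central difference of a primitive of [g] is the
    average of [g] over a window of radius [h]. *)
Definition cdiff h g x : R := g (x + h) - g (x - h).

Definition cdiff_poly h p : {poly R} := (p \Po ('X + h%:P)) - (p \Po ('X - h%:P)).

Lemma deriv_cdiff_poly h p : (cdiff_poly h p)^`() = cdiff_poly h p^`().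
Proof.
rewrite /cdiff_poly derivB !deriv_comp !derivD derivN derivX !derivC.
by rewrite oppr0 addr0 !mulr1.
Qed.

Lemma horner_cdiff_poly h p x : (cdiff_poly h p).[x] = p.[x + h] - p.[x - h].
Proof. by rewrite /cdiff_poly hornerD hornerN !horner_comp !hornerE. Qed.

(** Each central difference lowers the degree by one, so [i] of them turn the
    polynomial of degree [i + 1] into an affine one. *)
Lemma cdiff_bernoulli h i : exists c,
  iter i (cdiff_poly h) (bernoulli R i) = (2 * h) ^+ i *: 'X + c%:P.
Proof.
have dpoly n p : (iter n (cdiff_poly h) p)^`() = iter n (cdiff_poly h) p^`().
  by elim: n => //= n <-; rewrite deriv_cdiff_poly.
elim: i => [|i [c IH]].
  by exists (- (1 / 2)); rewrite /= expr0 scale1r polyCN.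
set P := iter i.+1 _ _.
have dP : P^`() = ((2 * h) ^+ i.+1)%:P.
  rewrite dpoly deriv_bernoulli iterS IH /cdiff_poly.
  rewrite !comp_polyD !comp_polyZ !comp_polyX !comp_polyC -!mul_polyC.
  by rewrite exprS !polyCM [2%:P]rmorph_nat; ring.
have /deriv_eq0 E : (P - (2 * h) ^+ i.+1 *: 'X)^`() = 0.
  by rewrite derivB dP derivZ derivX alg_polyC subrr.
by exists (P - (2 * h) ^+ i.+1 *: 'X)`_0; rewrite -E addrC subrK.
Qed.

Lemma cdiff_circle_poly h p r x : 0 <= h -> r%:R * h < x -> x < 1 - r%:R * h ->
  iter r (cdiff h) (circle_poly p) x = (iter r (cdiff_poly h) p).[x].
Proof.
move=> h0; elim: r x => [|r IH] x.
  by rewrite mul0r subr0 => x0 x1; rewrite /= /circle_poly frac_id// ltW.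
rewrite -natr1 mulrDl mul1r => x0 x1.
rewrite iterS /cdiff horner_cdiff_poly !IH//; lra.
Qed.

Lemma periodic_cdiff h g r : periodic g 1 -> periodic (iter r (cdiff h) g) 1.
Proof.
move=> pg; elim: r => //= r IH x; rewrite /cdiff.
by rewrite (addrAC x 1 h) (addrAC x 1 (- h)) !IH.
Qed.

Lemma continuous_cdiff h g r : continuous g -> continuous (iter r (cdiff h) g).
Proof.
move=> cg; elim: r => //= r IH x.
have sh c : (y + c) @[y --> x] --> x + c.
  by apply: cvgD; [exact: cvg_id | exact: cvg_cst].
by apply: cvgB; [apply: (cvg_comp _ _ (sh h)) | apply: (cvg_comp _ _ (sh (- h)))];
  exact: IH.
Qed.

Lemma is_derive_translate g (d c x : R) :
  is_derive (x + c) 1 g d -> is_derive x 1 (fun y => g (y + c)) d.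
Proof.
move=> gd; have := @is_derive1_comp _ g (shift c) x d 1 gd (is_derive_shift _ _ _).
by rewrite mulr1.
Qed.

Lemma is_derive_cdiff h g dg r : (forall x : R, is_derive x 1 g (dg x)) ->
  forall x : R, is_derive x 1 (iter r (cdiff h) g) (iter r (cdiff h) dg x).
Proof.
move=> dgx; elim: r => //= r IH x.
exact: (is_deriveB (is_derive_translate (IH _)) (is_derive_translate (IH _))).
Qed.

Lemma cdiff_lipschitz h g r gamma L :
  (forall x, `|g (x - gamma) - g x| <= L) ->
  forall x, `|iter r (cdiff h) g (x - gamma) - iter r (cdiff h) g x|
    <= 2 ^+ r * L.
Proof.
move=> gL; elim: r => [|r IH] x; first by rewrite expr0 mul1r.
rewrite !iterS /cdiff; set G := iter r _ _ in IH *.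
have -> : G (x - gamma + h) - G (x - gamma - h) - (G (x + h) - G (x - h)) =
  (G (x + h - gamma) - G (x + h)) - (G (x - h - gamma) - G (x - h)).
  by rewrite [x + h - gamma]addrAC [x - h - gamma]addrAC; ring.
apply: le_trans (ler_normB _ _) _; rewrite exprS -mulrA mulrDl mul1r.
by rewrite lerD.
Qed.

(** A [k + 1]-fold average of the sawtooth over windows whose radii add up to
    less than [delta].  Averaging reproduces affine functions, so nothing
    changes at distance [delta] from the jump; each derivative costs a factor
    [1 / delta], and the last one is saved for the Lipschitz bound. *)
Lemma smooth_sawtooth (k : nat) : exists2 C : R, 0 <= C &
  forall delta : R, 0 < delta -> exists U : nat -> R -> R,
  [/\ forall j (x : R), (j < k)%N -> is_derive x 1 (U j) (U j.+1 x),
      forall j, (j <= k)%N -> continuous (U j),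
      forall j, periodic (U j) 1,
      forall j gamma x, (j <= k)%N ->
        `|U j (x - gamma) - U j x| <= C / delta ^+ k.+1 * dist_int gamma
    & forall x, delta <= dist_int x -> sawtooth x = U 0%N x].
Proof.
pose b i := circle_poly (bernoulli R i).
have /choice[L HL] : forall i, exists C, 0 <= C /\ forall x gamma,
    `|b i.+1 (x - gamma) - b i.+1 x| <= C * dist_int gamma.
  move=> i; have [C C0 HC] := circle_poly_lipschitz (bernoulli_closes R i).
  by exists C.
pose Lm := \sum_(0 <= i < k.+1) L i.
have L0 i : 0 <= L i by have [] := HL i.
have Lm0 : 0 <= Lm by apply: sumr_ge0.
have LLm i : (i <= k)%N -> L i <= Lm.
  move=> ik; rewrite /Lm (bigD1_seq i) ?iota_uniq ?mem_index_iota//=.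
  by rewrite lerDl sumr_ge0.
have bc i : continuous (b i.+1).
  have [C C0 HC] := circle_poly_lipschitz (bernoulli_closes R i).
  move=> x; apply/cvgrPdist_lt => e e0.
  have C1 : 0 < C + 1 by rewrite ltr_wpDl.
  near=> y; apply: (@le_lt_trans _ _ (C * `|x - y|)).
    have := HC y (y - x); rewrite subKr => /le_trans; apply.
    rewrite ler_wpM2l// -normrN opprB; have := dist_int_le (y - x) 0.
    by rewrite subr0.
  apply: (@le_lt_trans _ _ ((C + 1) * `|x - y|)).
    by rewrite ler_wpM2r// lerDl.
  rewrite mulrC -ltr_pdivlMr//; near: y.
  by apply: cvgr_dist_lt; rewrite ?divr_gt0//; exact: cvg_id.
exists ((k.+2)%:R ^+ k.+1 * Lm); first by rewrite mulr_ge0// exprn_ge0.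
move=> delta d0; pose h := delta / k.+2%:R.
have h0 : 0 < h by rewrite divr_gt0// ltr0n.
have hr0 : (2 * h) ^+ k.+1 != 0 by rewrite expf_neq0// mulf_neq0// gt_eqF.
have [c Hc] := cdiff_bernoulli h k.+1.
pose A := ((2 * h) ^+ k.+1)^-1.
(* the averages match the sawtooth only up to a constant, subtracted here *)
pose cst0 j : R := if j == 0%N then A * c + 1 / 2 else 0.
exists (fun j x => A * iter k.+1 (cdiff h) (b (k.+1 - j)%N) x - cst0 j).
split.
- move=> j x jk.
  have D (y : R) : is_derive y 1 (b (k.+1 - j)%N) (b (k.+1 - j.+1)%N y).
    rewrite subSS subSn 1?ltnW// -(subnSK jk) /b.
    rewrite -[bernoulli R (k - j.+1).+1]deriv_bernoulli.
    apply: is_derive_circle_poly; first exact: bernoulli_closes.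
    by rewrite !deriv_bernoulli; exact: bernoulli_closes.
  exact: (is_deriveB (is_deriveZ A (is_derive_cdiff h k.+1 D x))
    (is_derive_cst (cst0 j) x 1)).
- move=> j jk x; apply: cvgB; last exact: cvg_cst.
  apply: cvgM; first exact: cvg_cst.
  by apply: continuous_cdiff; rewrite subSn//; exact: bc.
- move=> j x; rewrite periodic_cdiff//; exact: circle_poly_periodic.
- move=> j gamma x jk.
  set g := iter _ _ _.
  have -> : A * g (x - gamma) - cst0 j - (A * g x - cst0 j) = A * (g (x - gamma) - g x) by ring.
  have A0 : 0 <= A by rewrite invr_ge0 exprn_ge0// mulr_ge0// ltW.
  rewrite normrM (ger0_norm A0).
  have lip : `|g (x - gamma) - g x| <= 2 ^+ k.+1 * (Lm * dist_int gamma).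
    apply: cdiff_lipschitz => y; rewrite subSn//.
    have [_ /(_ y gamma) /le_trans->//] := HL (k - j)%N.
    by rewrite ler_wpM2r ?dist_int_ge0// LLm// leq_subr.
  apply: (le_trans (ler_wpM2l A0 lip)).
  rewrite le_eqVlt; apply/orP; left; apply/eqP.
  rewrite /A /h exprMn expr_div_n; field.
  by rewrite !expf_neq0 ?gt_eqF// pnatr_eq0.
- move=> x dx.
  have /andP[f0 f1] := frac_itv x.
  have kh : k.+1%:R * h < delta.
    by rewrite /h mulrA ltr_pdivrMr ?ltr0n// mulrC ltr_pM2l// ltr_nat.
  have x1 := le_trans dx (dist_int_le x (Num.floor x)).
  have x2 := le_trans dx (dist_int_le x (Num.floor x + 1)).
  rewrite -/(frac x) ger0_norm// in x1.
  rewrite intrD opprD addrA -/(frac x) ler0_norm in x2; last by rewrite subr_le0 ltW.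
  have px : iter k.+1 (cdiff h) (b k.+1) x = iter k.+1 (cdiff h) (b k.+1) (frac x).
    rewrite -[in RHS](@periodic_int _ _ _ (Num.floor x)); last first.
      by apply: periodic_cdiff; exact: circle_poly_periodic.
    by rewrite /frac subrK.
  rewrite subn0 px cdiff_circle_poly//; last 3 first.
  + exact: ltW.
  + exact: lt_le_trans x1.
  + lra.
  have AK : A * (2 * h) ^+ k.+1 = 1 by rewrite mulVf.
  by rewrite Hc hornerD hornerZ hornerX hornerC /cst0 /= mulrDr mulrA AK /sawtooth; ring.
Unshelve. all: by end_near. Qed.

End box_smoothing.

(** * Cosine polynomials and powers of the Fejer kernel *)

Section cosine_polynomials.
Variable R : realType.
Implicit Types (f g : R -> R) (t : R).

(** Nonnegative coefficients are preserved by products, and their sum is the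
    value at 0. *)
Definition pos_cospoly (N : nat) f := exists a : nat -> R,
  (forall k, 0 <= a k) /\
  forall t, f t = \sum_(0 <= k < N.+1) a k * cos (2 * k%:R * t).

Lemma pos_cospoly_ext N f g : f =1 g -> pos_cospoly N f -> pos_cospoly N g.
Proof. by move=> fg [a [a0 fa]]; exists a; split => // t; rewrite -fg. Qed.

Lemma pos_cospoly_cos N k : (k <= N)%N -> pos_cospoly N (fun t => cos (2 * k%:R * t)).
Proof.
move=> kN; exists (fun j => (j == k)%:R); split => // t.
rewrite (bigD1_seq k) ?iota_uniq ?mem_index_iota ?ltnS ?kN//= eqxx mul1r.
by rewrite big1 ?addr0// => j /negPf ->; rewrite mulr0n mul0r.
Qed.

Lemma pos_cospolyD N f g : pos_cospoly N f -> pos_cospoly N g ->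
  pos_cospoly N (fun t => f t + g t).
Proof.
move=> [a [a0 fa]] [b [b0 gb]]; exists (fun k => a k + b k); split.
  by move=> k; rewrite addr_ge0.
by move=> t; rewrite fa gb -big_split /=; apply: eq_bigr => k _; ring.
Qed.

Lemma pos_cospolyZ N c f : 0 <= c -> pos_cospoly N f ->
  pos_cospoly N (fun t => c * f t).
Proof.
move=> c0 [a [a0 fa]]; exists (fun k => c * a k); split.
  by move=> k; rewrite mulr_ge0.
by move=> t; rewrite fa mulr_sumr; apply: eq_bigr => k _; rewrite mulrA.
Qed.

Lemma pos_cospoly_sum N n (F : nat -> R -> R) :
  (forall i, (i < n)%N -> pos_cospoly N (F i)) ->
  pos_cospoly N (fun t => \sum_(0 <= i < n) F i t).
Proof.
elim: n => [|n IH] HF.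
  exists (fun=> 0); split => // t; rewrite big_geq// big1// => k _.
  by rewrite mul0r.
apply: (pos_cospoly_ext (f := fun t => \sum_(0 <= i < n) F i t + F n t)).
  by move=> t; rewrite big_nat_recr.
by apply: pos_cospolyD; [apply: IH => i /ltnW/HF | exact: HF].
Qed.

Lemma cos_diff_distn i j t :
  cos (2 * i%:R * t - 2 * j%:R * t) = cos (2 * (`|i%:Z - j%:Z|%N)%:R * t).
Proof.
have [ij|/ltnW ji] := leqP i j.
  rewrite distnEr// natrB// -cosN; congr cos; ring.
by rewrite distnEl// natrB//; congr cos; ring.
Qed.

Lemma pos_cospolyM N1 N2 f g : pos_cospoly N1 f -> pos_cospoly N2 g ->
  pos_cospoly (N1 + N2) (fun t => f t * g t).
Proof.
move=> [a [a0 fa]] [b [b0 gb]].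
pose h t := \sum_(0 <= i < N1.+1) \sum_(0 <= j < N2.+1)
    (a i * b j / 2) * (cos (2 * (i + j)%:R * t)
                       + cos (2 * (`|i%:Z - j%:Z|%N)%:R * t)).
apply: (pos_cospoly_ext (f := h)); last first.
  apply: pos_cospoly_sum => i iN; apply: pos_cospoly_sum => j jN.
  apply: pos_cospolyZ; first by rewrite divr_ge0// mulr_ge0.
  by apply: pos_cospolyD; apply: pos_cospoly_cos; lia.
move=> t; rewrite fa gb mulr_suml; apply: eq_bigr => i _; rewrite mulr_sumr.
apply: eq_bigr => j _; rewrite -cos_diff_distn natrD.
have -> : 2 * (i%:R + j%:R) * t = 2 * i%:R * t + 2 * j%:R * t by ring.
by rewrite cosD cosB; field.
Qed.

Lemma pos_cospolyX N f l : pos_cospoly N f ->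
  pos_cospoly (l * N) (fun t => f t ^+ l).
Proof.
move=> pf; elim: l => [|l IH].
  apply: (pos_cospoly_ext (f := fun t => cos (2 * 0%:R * t))).
    by move=> t; rewrite mulr0 mul0r cos0 expr0.
  exact: pos_cospoly_cos.
rewrite mulSn; apply: (pos_cospoly_ext (f := fun t => f t * f t ^+ l)).
  by move=> t; rewrite exprS.
exact: pos_cospolyM.
Qed.

(** The squared modulus of [\sum_(j < d) exp (2 i j t)]. *)
Definition fejer (d : nat) t : R :=
  (\sum_(0 <= j < d) cos (2 * j%:R * t)) ^+ 2
  + (\sum_(0 <= j < d) sin (2 * j%:R * t)) ^+ 2.

Lemma fejer_ge0 d t : 0 <= fejer d t.
Proof. by rewrite addr_ge0 ?sqr_ge0. Qed.

Lemma fejer0 d : fejer d 0 = d%:R ^+ 2.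
Proof.
rewrite /fejer (eq_bigr (fun=> 1)); last by move=> j _; rewrite mulr0 cos0.
rewrite [X in _ + X ^+ 2]big1; last by move=> j _; rewrite mulr0 sin0.
by rewrite sumr_const_nat subn0 expr0n addr0.
Qed.

Lemma pos_cospoly_fejer d : pos_cospoly d.-1 (fejer d).
Proof.
pose h t := \sum_(0 <= i < d) \sum_(0 <= j < d)
  cos (2 * (`|i%:Z - j%:Z|%N)%:R * t).
apply: (pos_cospoly_ext (f := h)); last first.
  apply: pos_cospoly_sum => i iN; apply: pos_cospoly_sum => j jN.
  by apply: pos_cospoly_cos; lia.
move=> t; rewrite /fejer !expr2 !mulr_suml -big_split /=.
apply: eq_bigr => i _; rewrite !mulr_sumr -big_split /=.
by apply: eq_bigr => j _; rewrite -cos_diff_distn cosB.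
Qed.

Lemma sum_cos_telescope d t :
  2 * sin t * \sum_(0 <= j < d) cos (2 * j%:R * t) =
  sin ((2 * d%:R - 1) * t) + sin t.
Proof.
rewrite mulr_sumr.
rewrite (telescope_sumr_eq (fun j => sin ((2 * j%:R - 1) * t)))//.
  by rewrite mulr0 sub0r mulN1r sinN opprK.
move=> j _; rewrite -[j.+1%:R]natr1.
have -> : (2 * (j%:R + 1) - 1) * t = 2 * j%:R * t + t by ring.
have -> : (2 * j%:R - 1) * t = 2 * j%:R * t - t by ring.
by rewrite sinD sinB; ring.
Qed.

Lemma sum_sin_telescope d t :
  2 * sin t * \sum_(0 <= j < d) sin (2 * j%:R * t) =
  cos t - cos ((2 * d%:R - 1) * t).
Proof.
rewrite mulr_sumr.
rewrite (telescope_sumr_eq (fun j => - cos ((2 * j%:R - 1) * t)))//.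
  by rewrite mulr0 sub0r mulN1r cosN opprK addrC.
move=> j _; rewrite -[j.+1%:R]natr1.
have -> : (2 * (j%:R + 1) - 1) * t = 2 * j%:R * t + t by ring.
have -> : (2 * j%:R - 1) * t = 2 * j%:R * t - t by ring.
by rewrite cosD cosB; ring.
Qed.

Lemma fejer_le d t : sin t ^+ 2 * fejer d t <= 1.
Proof.
have E : 4 * (sin t ^+ 2 * fejer d t) =
    (sin ((2 * d%:R - 1) * t) + sin t) ^+ 2
    + (cos t - cos ((2 * d%:R - 1) * t)) ^+ 2.
  by rewrite -sum_cos_telescope -sum_sin_telescope /fejer; ring.
set p := (2 * d%:R - 1) * t in E.
have h1 := cos2Dsin2 t; have h2 := cos2Dsin2 p.
have h3 := sqr_ge0 (sin p - sin t); have h4 := sqr_ge0 (cos t + cos p).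
nra.
Qed.

(** The mean of a cosine polynomial of degree below [M] is its average over the
    [M] points [pi j / M]; when it is nonnegative the single point 0 already
    bounds the mean from below. *)
Lemma pos_cospoly_mean N f (a : nat -> R) :
  (forall t, f t = \sum_(0 <= k < N.+1) a k * cos (2 * k%:R * t)) ->
  (forall t, 0 <= f t) -> f 0 <= N.+1%:R * a 0%N.
Proof.
move=> fa f0; set M := N.+1.
have M0 : M%:R != 0 :> R by rewrite pnatr_eq0.
have avg : \sum_(0 <= j < M) f (pi * j%:R / M%:R) = M%:R * a 0%N.
  under eq_bigr do rewrite fa.
  rewrite exchange_big /= big_nat_recl//= [X in _ + X]big1_seq ?addr0.
    under eq_bigr do rewrite mulr0 mul0r cos0 mulr1.
    by rewrite sumr_const_nat subn0 mulr_natl.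
  move=> k /andP[_]; rewrite mem_index_iota => /andP[_ kN].
  pose t : R := pi * k.+1%:R / M%:R.
  rewrite (eq_bigr (fun j => a k.+1 * cos (2 * j%:R * t))); last first.
    by move=> j _; congr (_ * cos _); rewrite /t; field.
  rewrite -mulr_sumr; suff -> : \sum_(0 <= j < M) cos (2 * j%:R * t) = 0.
    by rewrite mulr0.
  have st : 0 < sin t.
    apply: sin_gt0_pi; rewrite /t divr_gt0 ?mulr_gt0 ?pi_gt0 ?ltr0n//=.
    by rewrite ltr_pdivrMr ?ltr0n// ltr_pM2l ?pi_gt0// ltr_nat.
  have := sum_cos_telescope M t.
  have -> : (2 * M%:R - 1) * t = - t + (pi *+ 2) *+ k.+1.
    by rewrite /t -mulr_natr -(mulr_natr pi); field.
  rewrite (periodicn (@sinD2pi R)) sinN addNr => /eqP.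
  by rewrite !mulf_eq0 pnatr_eq0 (gt_eqF st) /= => /eqP.
rewrite -avg big_nat_recl//= mulr0 mul0r lerDl.
by apply: sumr_ge0.
Qed.

(** Half of Jordan's bound, from [sin z >= z cos z] at the half angle
    [z = pi x / 2], where [2 (cos z)^2 = 1 + cos (2 z) >= 1]. *)
Lemma sin_pi_ge (x : R) : 0 <= x <= 1 / 2 -> x <= sin (pi * x).
Proof.
move=> /andP[x0 x1]; have p0 := @pi_gt0 R; have p2 := @pi_ge2 R.
pose z : R := pi * x / 2.
have z0 : 0 <= z by rewrite divr_ge0// mulr_ge0// ltW.
have z1 : 2 * z <= pi / 2 by rewrite /z; nra.
have c2 : 0 <= cos (2 * z) by apply: cos_ge0_pihalf; apply/andP; split; lra.
have cz : 0 <= cos z by apply: cos_ge0_pihalf; apply/andP; split; lra.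
have sz : z * cos z <= sin z.
  have D (y : R) : is_derive y 1 (fun y => sin y - y * cos y) (y * sin y).
    apply: is_derive_eq (is_deriveB (is_derive_sin y)
      (is_deriveM (is_derive_id y 1) (is_derive_cos y))) _.
    by rewrite /GRing.scale /=; ring.
  have [|c] := MVT_segment z0 (fun y _ => D y).
    apply: derivable_within_continuous => y _.
    by have [] := D y.
  rewrite in_itv /= => /andP[c0 cz'].
  rewrite sin0 mul0r !subr0 => E; rewrite -subr_ge0 E.
  apply: mulr_ge0 => //; apply: mulr_ge0 => //.
  apply: sin_ge0_pi; apply/andP; split; lra.
have e : pi * x = z + z by rewrite /z; field.
rewrite e sinD; have : cos (2 * z) = 2 * cos z ^+ 2 - 1.
  by rewrite mulr2n mulrDl mul1r cosD; have := cos2Dsin2 z; rewrite !expr2; lra.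
move=> ec; have : x <= z by rewrite /z; nra.
nra.
Qed.

End cosine_polynomials.

(** * Trigonometric approximation of the sawtooth *)

Section trigonometric_sawtooth.
Variable R : realType.
Implicit Types (a : nat -> R) (x y h : R).

(** Powers of the Fejer kernel, normalized to mean 1.  Their size decays like
    [(d x)^(-2 l)] although their degree is only [l d]. *)
Lemma concentrated_kernel (d l : nat) : (0 < d)%N -> (0 < l)%N ->
  exists N a, [/\ (N < l * d)%N, forall k, 0 <= a k, a 0%N = 1,
    \sum_(0 <= k < N.+1) a k <= (l * d)%:R &
    forall x, let K := \sum_(0 <= k < N.+1) a k * cos (2 * k%:R * (pi * x)) in
      0 <= K /\ (0 < x <= 1 / 2 -> K <= (l * d)%:R / (d%:R * x) ^+ (2 * l))].
Proof.
move=> d0 l0; have [a [a0 fa]] := pos_cospolyX l (pos_cospoly_fejer R d).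
set N := (l * d.-1)%N in fa.
have Nld : (N < l * d)%N.
  by rewrite /N -subn1 mulnBr muln1 ltn_subrL l0 muln_gt0 l0.
have f0 (t : R) : 0 <= fejer d t ^+ l by rewrite exprn_ge0// fejer_ge0.
have mean := pos_cospoly_mean fa f0.
rewrite fejer0 -exprM in mean.
have dp : 0 < (d%:R : R) ^+ (2 * l) by rewrite exprn_gt0// ltr0n.
have Nl : N.+1%:R <= (l * d)%:R :> R by rewrite ler_nat.
have mean' : (d%:R : R) ^+ (2 * l) <= (l * d)%:R * a 0%N.
  by apply: (le_trans mean); rewrite ler_wpM2r.
have ap : 0 < a 0%N.
  rewrite lt_neqAle a0 andbT eq_sym; apply: contraTneq dp => az.
  by rewrite -leNgt; apply: (le_trans mean'); rewrite az mulr0.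
exists N, (fun k => a k / a 0%N); split => //.
- by move=> k; rewrite divr_ge0.
- by rewrite divff// gt_eqF.
- rewrite -mulr_suml ler_pdivrMr//; apply: le_trans mean'.
  rewrite exprM -fejer0 fa.
  by apply: ler_sum => k _; rewrite mulr0 cos0 mulr1.
- move=> x K; have KE : K = fejer d (pi * x) ^+ l / a 0%N.
    by rewrite fa mulr_suml; apply: eq_bigr => k _; rewrite mulrAC.
  split; first by rewrite KE divr_ge0.
  move=> /andP[x0 x1]; rewrite KE ler_pdivrMr// exprMn invfM mulrA mulrAC.
  have F2 : fejer d (pi * x) <= (x ^+ 2)^-1.
    rewrite -[leRHS]mul1r ler_pdivlMr ?exprn_gt0//.
    apply: le_trans (fejer_le d (pi * x)); rewrite mulrC ler_wpM2r ?fejer_ge0//.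
    have sx : x <= sin (pi * x) by apply: sin_pi_ge; rewrite ltW.
    by rewrite lerXn2r ?nnegrE ?(le_trans (ltW x0) sx)// ltW.
  apply: (@le_trans _ _ ((x ^+ (2 * l))^-1)).
    rewrite exprM -exprVn lerXn2r ?nnegrE ?fejer_ge0//.
    by rewrite invr_ge0 sqr_ge0.
  rewrite ler_peMl ?invr_ge0 ?exprn_ge0 ?(ltW x0)//.
  by rewrite mulrAC ler_pdivlMr// mul1r.
Qed.

(** The odd primitive of [1 - K], where [K] is the kernel with cosine
    coefficients [a] and [a 0 = 1]. *)
Definition trig_sawtooth (N : nat) a x : R :=
  - \sum_(0 <= k < N) a k.+1 * (sin (2 * k.+1%:R * pi * x) / (2 * k.+1%:R * pi)).

Lemma trig_sawtooth_periodic N a : periodic (trig_sawtooth N a) 1.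
Proof.
move=> x; congr (- _); apply: eq_bigr => k _; congr (_ * (_ / _)).
rewrite -[RHS](periodicn (@sinD2pi R) k.+1) -mulr_natr -(mulr_natr pi).
by congr sin; ring.
Qed.

Lemma trig_sawtoothN N a x : trig_sawtooth N a (- x) = - trig_sawtooth N a x.
Proof.
rewrite /trig_sawtooth opprK -sumrN; apply: eq_bigr => k _.
by rewrite mulrN sinN mulNr mulrN opprK.
Qed.

Lemma continuous_trig_sawtooth N a : continuous (trig_sawtooth N a).
Proof.
move=> x; apply: cvgN; elim: N => [|N IH].
  by under eq_fun do rewrite big_geq//; rewrite big_geq//; exact: cvg_cst.
under eq_fun do rewrite big_nat_recr//=; rewrite big_nat_recr//=.
apply: cvgD => //; apply: cvgM; first exact: cvg_cst.
apply: cvgM; last exact: cvg_cst.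
apply: cvg_comp; last exact: continuous_sin.
by apply: cvgM; [exact: cvg_cst | exact: cvg_id].
Qed.

Lemma is_derive_trig_error N a x : a 0%N = 1 ->
  is_derive x 1 (fun y => y - 1 / 2 - trig_sawtooth N a y)
    (\sum_(0 <= k < N.+1) a k * cos (2 * k%:R * (pi * x))).
Proof.
move=> a0; elim: N => [|N IH].
  rewrite big_nat1 a0 mulr0 mul0r cos0 mulr1.
  rewrite (_ : (fun y => _) = id - cst (1 / 2)); last first.
    by apply/funext => y; rewrite /trig_sawtooth big_geq// oppr0 subr0.
  apply: is_derive_eq (is_deriveB (is_derive_id x 1) (is_derive_cst _ x 1)) _.
  by rewrite subr0.
pose w : R := 2 * N.+1%:R * pi.
have w0 : w != 0 by rewrite mulf_neq0 ?mulf_neq0 ?pnatr_eq0// gt_eqF// pi_gt0.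
rewrite (_ : (fun y => _) = (fun y => y - 1 / 2 - trig_sawtooth N a y) +
    (a N.+1 / w) *: (sin \o ( *%R w))); last first.
  apply/funext => y; rewrite /trig_sawtooth big_nat_recr//= !fctE /GRing.scale /=.
  by rewrite -/w; ring.
have dw : is_derive x 1 ( *%R w) w.
  by apply: is_derive_eq (is_deriveZ w (is_derive_id x 1)) _; rewrite [LHS]mulr1.
apply: is_derive_eq (is_deriveD IH (is_deriveZ _ (is_derive1_comp
  (is_derive_sin _) dw))) _.
rewrite [RHS]big_nat_recr//=; congr (_ + _); rewrite /GRing.scale /=.
have -> : 2 * N.+1%:R * (pi * x) = w * x by rewrite /w; ring.
by field.
Qed.

Lemma trig_sawtooth_half N a : trig_sawtooth N a (1 / 2) = 0.
Proof.
rewrite /trig_sawtooth big1 ?oppr0// => k _.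
rewrite (_ : 2 * k.+1%:R * pi * (1 / 2) = 0 + pi *+ k.+1); last first.
  by rewrite -mulr_natr; field.
by rewrite (alternatingn (@sinDpi R)) sin0 mulr0 mul0r mulr0.
Qed.

Lemma sawtooth_frac_reduce N a y : 0 < dist_int y ->
  `|sawtooth y - trig_sawtooth N a y| =
  `|dist_int y - 1 / 2 - trig_sawtooth N a (dist_int y)|.
Proof.
have [m dm] := dist_intP y; have := dist_int_le_half y; rewrite dm.
set t := y - m%:~R => th t0.
have yt : y = t + m%:~R by rewrite /t subrK.
have -> : sawtooth y = sawtooth t by rewrite /sawtooth yt fracDz.
have -> : trig_sawtooth N a y = trig_sawtooth N a t.
  by rewrite yt periodic_int//; exact: trig_sawtooth_periodic.
have [t1|t1] := ger0P t; rewrite ?(ger0_norm t1) ?(ltr0_norm t1) in th t0.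
  by rewrite /sawtooth frac_id//; apply/andP; split; lra.
rewrite trig_sawtoothN -[in LHS]normrN; congr `|_|.
rewrite /sawtooth -(@fracDz _ t 1) frac_id; first by rewrite mulr1z; field.
by apply/andP; split; lra.
Qed.

(** The error has derivative the kernel and vanishes at 1/2; comparing with the
    primitive of the bound [y^(-3)] keeps the factor that mere bounding of the
    kernel by its supremum would lose. *)
Lemma trig_sawtooth_error (d l : nat) : (0 < d)%N -> (1 < l)%N ->
  exists N a, [/\ (N < l * d)%N, forall k, 0 <= a k,
    \sum_(0 <= k < N.+1) a k <= (l * d)%:R &
    forall y, 2 / d%:R <= dist_int y ->
      `|sawtooth y - trig_sawtooth N a y| <=
        (4 * l%:R / (4 ^+ l * d%:R ^+ 2)) / dist_int y ^+ 2].
Proof.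
move=> d0 l1; have [N [a [Nld a0 a01 aS HK]]] := concentrated_kernel d0 (ltnW l1).
exists N, a; split => // y dy.
have d0' : 0 < d%:R :> R by rewrite ltr0n.
have y0 : 0 < dist_int y by apply: lt_le_trans dy; rewrite divr_gt0.
rewrite sawtooth_frac_reduce//; set x := dist_int y in dy y0 *.
have x1 : x <= 1 / 2 := dist_int_le_half y.
set A := 4 * l%:R / _; pose E z := z - 1 / 2 - trig_sawtooth N a z.
have dE (z : R) : is_derive z 1 E (\sum_(0 <= k < N.+1) a k * cos (2 * k%:R * (pi * z))).
  exact: is_derive_trig_error.
have Kle (z : R) : x <= z <= 1 / 2 ->
    \sum_(0 <= k < N.+1) a k * cos (2 * k%:R * (pi * z)) <= 2 * A * (z ^+ 3)^-1.
  move=> /andP[xz z1]; have z0 := lt_le_trans y0 xz.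
  have [_ /(_ _)/le_trans-> //] := HK z; first by rewrite z0.
  have dz2 : 2 <= d%:R * z.
    by rewrite mulrC -ler_pdivrMr//; exact: le_trans xz.
  have e2l : (2 * l = 3 + (2 * l - 3))%N by lia.
  have p0 : (0 : R) < 2 ^+ (2 * l - 3) by rewrite exprn_gt0.
  have z3 : 0 < (d%:R * z) ^+ 3 by rewrite exprn_gt0// mulr_gt0.
  have -> : 2 * A * (z ^+ 3)^-1 =
      (l * d)%:R / ((d%:R * z) ^+ 3 * 2 ^+ (2 * l - 3)).
    have -> : 2 ^+ (2 * l - 3) = 4 ^+ l / 8 :> R.
      have -> : 4 ^+ l = 2 ^+ (2 * l) :> R by rewrite exprM; congr (_ ^+ _); ring.
      by rewrite [in RHS]e2l exprD; field.
    rewrite /A natrM exprMn; field.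
    by rewrite !expf_neq0 ?gt_eqF//.
  rewrite ler_wpM2l// lef_pV2 ?posrE ?mulr_gt0 ?exprn_gt0 ?mulr_gt0//.
  rewrite {2}e2l exprD ler_wpM2l// ?(ltW z3)//.
  by rewrite lerXn2r ?nnegrE// ltW// mulr_gt0.
have E12 : E (1 / 2) = 0 by rewrite /E trig_sawtooth_half; ring.
have Eup : E x <= 0.
  have [|c _ Ec] := MVT_segment x1 (fun z _ => dE z).
    by apply: derivable_within_continuous => z _; have [] := dE z.
  have [K0 _] := HK c; move: Ec; rewrite E12 sub0r => Ec.
  by rewrite -oppr_ge0 Ec mulr_ge0// subr_ge0.
pose H z := E z + A * z^-1 ^+ 2.
have dH (z : R) : x <= z -> is_derive z 1 H
    (\sum_(0 <= k < N.+1) a k * cos (2 * k%:R * (pi * z)) - 2 * A * (z ^+ 3)^-1).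
  move=> xz; have z0 : z != 0 by rewrite gt_eqF// (lt_le_trans y0).
  have dV := is_deriveX 2 (is_derive_inv z0).
  rewrite (_ : H = E + A *: ((fun t : R => t^-1) ^+ 2)); last first.
    by apply/funext => t; rewrite !fctE.
  apply: is_derive_eq (is_deriveD (dE z) (is_deriveZ A dV)) _.
  by rewrite /GRing.scale /= expr1; field.
have Hdn : H (1 / 2) <= H x.
  have cH : {within `[x, 1 / 2], continuous H}.
    apply: derivable_within_continuous => z; rewrite in_itv /= => /andP[xz _].
    by have [] := dH z xz.
  have dH' z : z \in `]x, 1 / 2[ -> is_derive z 1 H
    (\sum_(0 <= k < N.+1) a k * cos (2 * k%:R * (pi * z)) - 2 * A * (z ^+ 3)^-1).
    by rewrite in_itv /= => /andP[/ltW xz _]; exact: dH.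
  have [c] := MVT_segment x1 dH' cH.
  rewrite in_itv /= => cx Hc; rewrite -subr_le0 Hc mulr_le0_ge0 ?subr_ge0//.
  by rewrite subr_le0 Kle.
have Hx0 : 0 <= H x.
  apply: le_trans Hdn; rewrite /H E12 add0r mulr_ge0// ?sqr_ge0//.
  by rewrite /A divr_ge0 ?mulr_ge0 ?exprn_ge0// ltW// exprn_gt0.
move: Hx0; rewrite /H exprVn ler0_norm//; rewrite /E; lra.
Qed.

Lemma sin_cos_lipschitz (x y : R) :
  `|sin y - sin x| <= `|y - x| /\ `|cos y - cos x| <= `|y - x|.
Proof.
split.
  have := @derive_lipschitz R sin cos 1 (fun z => is_derive_sin z) _ x y.
  by rewrite mul1r; apply; exact: cos_max.
have := @derive_lipschitz R cos (fun z => - sin z) 1 (fun z => is_derive_cos z) _ x y.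
by rewrite mul1r; apply => z; rewrite normrN; exact: sin_max.
Qed.

(** Taylor coefficients at [y] of the increment of a sine wave of frequency
    [w]: at each order only one of the two parities contributes. *)
Lemma sine_increment_pseries (w y gamma : R) : 0 <= w ->
  exists c : nat -> R,
   (forall h, pseries c h @ \oo --> sin (w * (y - gamma + h)) - sin (w * (y + h)))
   /\ forall j, `|c j| <= w * `|gamma| * (w ^+ j / j`!%:R).
Proof.
move=> w0.
pose S1 := sin (w * (y - gamma)) - sin (w * y).
pose C1 := cos (w * (y - gamma)) - cos (w * y).
exists (fun j => (S1 * ((~~ odd j)%:R * (-1) ^+ j./2)
  + C1 * ((odd j)%:R * (-1) ^+ j.-1./2)) * (w ^+ j / j`!%:R)); split.
  move=> h.
  have -> : sin (w * (y - gamma + h)) - sin (w * (y + h)) =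
      S1 * cos (w * h) + C1 * sin (w * h).
    by rewrite !(mulrDr w _ h) !sinD /S1 /C1; ring.
  rewrite (_ : pseries _ h = fun n => S1 * series (cos_coeff (w * h)) n
     + C1 * series (sin_coeff (w * h)) n); last first.
    apply/funext => n; rewrite /pseries /series /= !mulr_sumr -big_split /=.
    apply: eq_bigr => j _; rewrite /cos_coeff /sin_coeff /= !exprMn.
    by rewrite ?exprnP; ring.
  apply: cvgD; apply: cvgM; try exact: cvg_cst.
    by rewrite cos.unlock; exact: is_cvg_series_cos_coeff.
  by rewrite sin.unlock; exact: is_cvg_series_sin_coeff.
move=> j; rewrite normrM (ger0_norm (_ : 0 <= w ^+ j / j`!%:R)); last first.
  by rewrite divr_ge0// exprn_ge0.
rewrite ler_wpM2r//; first by rewrite divr_ge0// exprn_ge0.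
have dist : `|w * (y - gamma) - w * y| = w * `|gamma|.
  by rewrite -mulrBr normrM (ger0_norm w0) addrAC subrr add0r normrN.
have [s1 s2] := sin_cos_lipschitz (w * y) (w * (y - gamma)).
rewrite dist in s1 s2.
case: (odd j) => /=; rewrite ?mul0r ?mulr0 ?mul1r ?add0r ?addr0 normrM
  normrX normrN normr1 expr1n mulr1; [exact: s2 | exact: s1].
Qed.

(** With the radius [1 / (2 pi)] the wave of frequency [2 pi k] contributes the
    exponential of [k]; the division by the frequency compensates the Lipschitz
    constant of the wave. *)
Lemma trig_increment_pseries (N : nat) a (D y gamma : R) :
  (forall k, 0 <= a k) -> \sum_(0 <= k < N.+1) a k <= D ->
  exists c : nat -> R,
   (forall h, pseries c h @ \oo -->
      trig_sawtooth N a (y + h - gamma) - trig_sawtooth N a (y + h))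
   /\ forall J, \sum_(0 <= j < J) `|c j| * (2 * pi)^-1 ^+ j <=
        D * dist_int gamma * expR N%:R.
Proof.
move=> a0 aD; have [m dm] := dist_intP gamma; pose g := gamma - m%:~R.
pose w (k : nat) : R := 2 * k.+1%:R * pi.
have w0 k : 0 < w k by rewrite !mulr_gt0 ?pi_gt0.
have /choice[c Hc] := fun k => sine_increment_pseries y g (ltW (w0 k)).
exists (fun j => \sum_(0 <= k < N) - (a k.+1 / w k) * c k j); split.
  move=> h.
  have -> : trig_sawtooth N a (y + h - gamma) = trig_sawtooth N a (y - g + h).
    rewrite -(@periodic_int _ _ (y + h - gamma) m (trig_sawtooth_periodic N a)).
    by congr trig_sawtooth; rewrite /g; ring.
  rewrite (_ : pseries _ h = fun n => \sum_(0 <= k < N)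
     - (a k.+1 / w k) * pseries (c k) h n); last first.
    apply/funext => n; rewrite /pseries /series /=.
    under eq_bigr do rewrite mulr_suml.
    rewrite exchange_big /=; apply: eq_bigr => k _.
    by rewrite mulr_sumr; apply: eq_bigr => j _; rewrite mulrA.
  rewrite /trig_sawtooth opprK addrC -sumrB.
  rewrite (_ : (fun n => _) = \sum_(0 <= k < N)
     (fun n => - (a k.+1 / w k) * pseries (c k) h n)); last first.
    by apply/funext => n; rewrite fct_sumE.
  apply: (big_ind2 (fun (u : nat -> R) l => u @ \oo --> l)) => [||k _].
  - exact: cvg_cst.
  - by move=> *; exact: cvgD.
  have [ck _] := Hc k.
  rewrite -/(w k) (_ : _ - _ = - (a k.+1 / w k) *
     (sin (w k * (y - g + h)) - sin (w k * (y + h)))); last by ring.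
  by apply: cvgM; [exact: cvg_cst | exact: ck].
move=> J; set r := (2 * pi)^-1.
have r0 : 0 < r by rewrite invr_gt0 mulr_gt0 ?pi_gt0.
have wr k : w k * r = k.+1%:R.
  rewrite /w /r (_ : 2 * _ * pi = k.+1%:R * (2 * pi)); last by ring.
  by rewrite mulfK// gt_eqF// mulr_gt0 ?pi_gt0.
apply: (@le_trans _ _ (\sum_(0 <= k < N) a k.+1 * (dist_int gamma * expR N%:R))).
  apply: (@le_trans _ _ (\sum_(0 <= j < J) \sum_(0 <= k < N)
     (a k.+1 / w k) * (`|c k j| * r ^+ j))).
    apply: ler_sum => j _.
    rewrite [leRHS](eq_bigr (fun k => (a k.+1 / w k * `|c k j|) * r ^+ j)); last first.
      by move=> k _; rewrite mulrA.
    rewrite -mulr_suml ler_wpM2r ?exprn_ge0 ?(ltW r0)//.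
    apply: le_trans (ler_norm_sum _ _ _) _; apply: ler_sum => k _.
    by rewrite normrM normrN (@ger0_norm _ (a k.+1 / w k))// divr_ge0// ltW.
  rewrite exchange_big /= !big_nat; apply: ler_sum => k /= kN.
  rewrite -mulr_sumr -mulrA ler_wpM2l// ler_pdivrMl//.
  have [_ ck] := Hc k.
  apply: (@le_trans _ _ (\sum_(0 <= j < J) w k * dist_int gamma *
      exp_coeff k.+1%:R j)).
    apply: ler_sum => j _; rewrite /exp_coeff /= -wr exprMn dm.
    have := ler_wpM2r (exprn_ge0 j (ltW r0)) (ck j).
    by move=> /le_trans; apply; rewrite le_eqVlt; apply/orP; left; apply/eqP; ring.
  rewrite -mulr_sumr -mulrA ler_wpM2l ?(ltW (w0 k))// ler_wpM2l ?dist_int_ge0//.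
  apply: (@le_trans _ _ (expR k.+1%:R)); last by rewrite ler_expR ler_nat.
  apply: nonneg_series_tail; last exact: is_cvg_series_exp_coeff.
  by move=> n; rewrite /exp_coeff /= divr_ge0// exprn_ge0.
rewrite -mulr_suml -mulrA ler_wpM2r ?mulr_ge0 ?dist_int_ge0 ?expR_ge0//.
by apply: le_trans aD; rewrite [leRHS]big_nat_recl//= lerDr.
Qed.

End trigonometric_sawtooth.

(** * Denominators of convergents *)

Section convergents.
Variable R : realType.
Implicit Types (x alpha : R) (m : int).

Lemma rational_int m : rational (m%:~R : R).
Proof. by exists m%:~R => //; rewrite ratr_int. Qed.

Lemma irrational_frac x : irrational x -> irrational (frac x).
Proof.
move=> xi [r _ rE]; apply: xi; exists (r + (Num.floor x)%:~R) => //.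
by rewrite rmorphD /= ratr_int rE /frac subrK.
Qed.

Lemma irrational_inv x : irrational x -> irrational x^-1.
Proof.
move=> xi [r _ rE]; apply: xi; exists r^-1 => //.
by rewrite fmorphV /= rE invrK.
Qed.

Lemma irrational_frac_gt0 x : irrational x -> 0 < frac x.
Proof.
move=> /irrational_frac xi; have /andP[f0 _] := frac_itv x.
rewrite lt_neqAle f0 andbT; apply/negP => /eqP e; apply: xi; rewrite -e.
exact: (rational_int 0).
Qed.

Lemma irrational_cf_complete alpha n : irrational alpha ->
  irrational (cf_complete alpha n).
Proof.
by move=> ai; elim: n => //= n IH; apply: irrational_inv; exact: irrational_frac.
Qed.

Lemma cf_quotient_ge1 alpha n : irrational alpha -> 1 <= cf_quotient alpha n.+1.
Proof.
move=> ai; rewrite floor_ge_int /= mulr1z.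
have /irrational_frac_gt0 f0 := @irrational_cf_complete _ n ai.
have /andP[_ f1] := frac_itv (cf_complete alpha n).
by rewrite invf_ge1// ltW.
Qed.

(** The recursion involves two predecessors, hence the induction on consecutive
    pairs. *)
Lemma cf_den_ge1 alpha n : irrational alpha -> 1 <= cf_den alpha n.
Proof.
move=> ai; suff : 1 <= cf_den alpha n /\ 1 <= cf_den alpha n.+1 by case.
elim: n => [|n [IH1 IH2]]; first by split => //; exact: cf_quotient_ge1.
split => //; have a1 := @cf_quotient_ge1 _ n.+1 ai.
rewrite [cf_den _ _](_ : _ = cf_quotient alpha n.+2 * cf_den alpha n.+1 + cf_den alpha n)//.
nia.
Qed.

Lemma dist_int_irrational_gt0 alpha (q : nat) : irrational alpha -> (0 < q)%N ->
  0 < dist_int (q%:R * alpha).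
Proof.
move=> ai q0; rewrite lt_neqAle dist_int_ge0 andbT eq_sym.
have [m ->] := dist_intP (q%:R * alpha).
rewrite normr_eq0 subr_eq0; apply/negP => /eqP e; apply: ai.
exists (m%:~R / q%:R) => //; rewrite fmorph_div /= ratr_int ratr_nat -e.
by rewrite mulrAC mulfV ?mul1r// pnatr_eq0 -lt0n.
Qed.

End convergents.

(** * Increments of the approximations in the two regularity classes *)

Section assembly.
Variable R : realType.
Local Notation mu := (@lebesgue_measure R).

(** What is required from the approximation [u] of the sawtooth used at one
    step of the series: the two terms bounded by [tau] estimate the measure of
    the set where the orbit comes too close to the jump and the integral of the
    accumulated error off this set. *)
Definition smoothing_data (alpha : R) (b : int) (q : nat) (tau : R)
    (u : R -> R) :=
  [/\ periodic u 1, measurable_fun [set: R] u &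
    exists delta A : R, [/\ 0 < delta, 0 <= A,
      forall y, delta <= dist_int y -> `|sawtooth y - u y| <= A / dist_int y ^+ 2 &
      q%:R * (delta + `|b%:~R| * dist_int (q%:R * alpha))
        + `|b%:~R| * q%:R * (A / delta) <= tau]].

(** The zero function serves for the finitely many first steps, which lets the
    sum of the remaining ones be small: the condition on the error is void since
    distances to the integers are at most 1/2. *)
Lemma smoothing_data_trivial alpha b q :
  smoothing_data alpha b q (q%:R * (1 + `|b%:~R| * dist_int (q%:R * alpha)))
    (fun=> 0).
Proof.
split => //; exists 1, 0; split => //; last by rewrite mul0r mulr0 addr0.
by move=> y; have := dist_int_le_half y; lra.
Qed.

Lemma cohomologous_of_smoothing_data (alpha beta : R) (b : nat -> int)
    (q : nat -> nat) (tau : nat -> R) (u : nat -> R -> R) (psi : R -> R) :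
  let G N := \sum_(0 <= n < N) (b n)%:~R * (q n)%:R * alpha in
  dist_int (G N - beta) @[N --> \oo] --> (0 : R) ->
  (forall n, smoothing_data alpha (b n) (q n) (tau n) (u n)) ->
  cvgn (series tau) ->
  (forall x, series (fun n => u n (x - G n.+1) - u n (x - G n)) @ \oo --> psi x) ->
  additively_cohomologous alpha (phi beta) psi.
Proof.
move=> G dG Hu ctau cpsi.
have /choice[delta Hd] : forall n, exists d, exists A : R, [/\ 0 < d, 0 <= A,
      forall y, d <= dist_int y -> `|sawtooth y - u n y| <= A / dist_int y ^+ 2 &
      (q n)%:R * (d + `|(b n)%:~R| * dist_int ((q n)%:R * alpha))
        + `|(b n)%:~R| * (q n)%:R * (A / d) <= tau n].
  by move=> n; have [_ _] := Hu n.
have /choice[A HA] := Hd.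
apply: (@cohomologous_of_smoothing _ _ _ (fun n => b n * (q n)%:Z) G u) => //.
- by rewrite /G big_geq.
- by move=> n; rewrite /G big_nat_recr//= intrM.
- by move=> n; have [] := Hu n.
- by move=> n; have [] := Hu n.
- apply: (@ae_cvg_birkhoff _ alpha b q (fun n y => sawtooth y - u n y) delta A tau G).
  + by move=> n; have [] := HA n.
  + by move=> n; have [] := HA n.
  + by move=> n; have [] := HA n.
  + by move=> n; have [] := HA n.
  + exact: ctau.
Qed.

Lemma sup_norm_lt (psi : R -> R) (m eps : R) :
  (forall x, `|psi x| <= m) -> m < eps -> (sup_norm psi < eps%:E)%E.
Proof.
move=> pm me; apply: (@le_lt_trans _ _ m%:E); last by rewrite lte_fin.
by apply: ge_ereal_sup => _ [x _ <-]; rewrite lee_fin.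
Qed.

(** With [s n] the summand of the hypothesis, the sawtooth is smoothed at scale
    [s n / q n].  The exceptional set then has measure of order [s n], and the
    [k]-th derivative of the increment is of order
    [|b n| ||q n alpha|| (q n / s n)^(k + 1) = s n]: the exponent [1 / (k + 2)]
    balances the two. *)
Lemma Ck_cohomologous (alpha beta : R) (b : nat -> int) (q : nat -> nat) (k : nat) :
  let G N := \sum_(0 <= n < N) (b n)%:~R * (q n)%:R * alpha in
  let D n := dist_int ((q n)%:R * alpha) in
  (forall n, b n != 0) -> (forall n, (0 < q n)%N) -> (forall n, 0 < D n) ->
  dist_int (G N - beta) @[N --> \oo] --> (0 : R) ->
  cvgn (series (fun n =>
    (`|(b n)%:~R| * (q n)%:R ^+ k.+1 * D n) `^ (k.+2%:R)^-1)) ->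
  forall eps : R, 0 < eps ->
    exists psi : R -> R,
      [/\ Ck_circle k psi, (sup_norm psi < eps%:E)%E
        & additively_cohomologous alpha (phi beta) psi].
Proof.
move=> G D b0 q0 D0 dG; set s := (fun n => _ `^ _) => cs eps eps0.
have b1 n : 0 < `|(b n)%:~R| :> R by rewrite normr_gt0 intr_eq0.
have q0' n : 0 < (q n)%:R :> R by rewrite ltr0n.
have P0 n : 0 < `|(b n)%:~R| * (q n)%:R ^+ k.+1 * D n.
  by rewrite !mulr_gt0// exprn_gt0.
have s0 n : 0 < s n by rewrite powR_gt0.
have sE n : s n ^+ k.+2 = `|(b n)%:~R| * (q n)%:R ^+ k.+1 * D n.
  by rewrite -powR_mulrn ?(ltW (s0 n))// -powRrM mulVf ?pnatr_eq0// powRr1// ltW.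
have [C C0 HC] := smooth_sawtooth R k.
have cCs := @cvg_series_scale _ s C cs.
have [N1 HN1] := series_tail_lt cCs eps0.
have [N2 _ HN2] : \forall n \near \oo, s n < 1.
  have /cvgrPdist_lt/(_ _ ltr01) := cvg_series_cvg_0 cs.
  by apply: filterS => n; rewrite sub0r normrN => /ltr_normlW.
pose N0 := maxn N1 N2.
pose M n := if (n < N0)%N then 0 else C * s n.
pose tau n := if (n < N0)%N then (q n)%:R * (1 + `|(b n)%:~R| * D n) else 2 * s n.
have dGS n : dist_int ((b n)%:~R * (q n)%:R * alpha) <= `|(b n)%:~R| * D n.
  by rewrite -mulrA; exact: dist_intMz.
have /choice[U HU] : forall n, exists U : nat -> R -> R,
  [/\ forall j (x : R), (j < k)%N -> is_derive x 1 (U j) (U j.+1 x),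
      forall j, (j <= k)%N -> continuous (U j),
      forall j, periodic (U j) 1,
      forall j x, (j <= k)%N ->
        `|U j (x - (b n)%:~R * (q n)%:R * alpha) - U j x| <= M n
    & smoothing_data alpha (b n) (q n) (tau n) (U 0%N)].
  move=> n; rewrite /M /tau; case: ltnP => nN.
    exists (fun _ _ => 0); split.
    - by move=> j x _; exact: is_derive_cst.
    - by move=> j _ x; exact: cvg_cst.
    - by move=> j x.
    - by move=> j x _; rewrite subrr normr0.
    - exact: smoothing_data_trivial.
  have [U [dU cU pU lU eU]] := HC (s n / (q n)%:R) (divr_gt0 (s0 n) (q0' n)).
  exists U; split => //.
    move=> j x jk; apply: le_trans (lU j _ x jk) _.
    apply: (@le_trans _ _ (C / (s n / (q n)%:R) ^+ k.+1 * (`|(b n)%:~R| * D n))).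
      rewrite ler_wpM2l// divr_ge0// exprn_ge0// divr_ge0// ltW//.
    rewrite le_eqVlt; apply/orP; left; apply/eqP.
    have sk0 : s n ^+ k.+1 != 0 by rewrite expf_neq0// gt_eqF.
    have qk0 : (q n)%:R ^+ k.+1 != 0 :> R by rewrite expf_neq0// gt_eqF.
    apply: (mulIf sk0); rewrite -[RHS]mulrA -exprS sE expr_div_n.
    by field; rewrite sk0 qk0.
  split; first exact: pU.
    by apply: continuous_measurable_fun; exact: cU.
  exists (s n / (q n)%:R), 0; split => //; first exact: divr_gt0.
    by move=> y /eU ->; rewrite subrr normr0 mul0r.
  (* |b| q ||q alpha|| <= s ^ (k + 2) <= s, since s <= 1 *)
  rewrite mul0r mulr0 addr0 mulrDr mulrCA divff ?gt_eqF// mulr1 mulrDl !mul1r lerD2l.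
  have sn1 : s n <= 1 by apply/ltW/HN2; rewrite /= (leq_trans _ nN)// leq_maxr.
  apply: (@le_trans _ _ (s n ^+ k.+2)); last first.
    by rewrite exprS ler_piMr ?(ltW (s0 n))// exprn_ile1// ltW.
  rewrite sE -/(D n) mulrCA mulrA ler_wpM2r ?(ltW (D0 n))// ler_wpM2l// exprS.
  by rewrite ler_peMr ?(ltW (q0' n))// exprn_ege1// ler1n.
pose T j n x := U n j (x - G n.+1) - U n j (x - G n).
have GS n x : x - G n.+1 = x - G n - (b n)%:~R * (q n)%:R * alpha.
  by rewrite /G big_nat_recr//= opprD addrA.
have TM j n x : (j <= k)%N -> `|T j n x| <= M n.
  by move=> jk; rewrite /T GS; have [_ _ _ /(_ j _ jk)] := HU n.
have cutM := cvg_series_cut (N := N0) cCs.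
have cM : cvgn (series M) by apply/cvg_ex; eexists; exact: cutM.
have ctau : cvgn (series tau).
  apply: (@cvg_series_eventually _ (fun n => 2 * s n) _ N0).
    by move=> n nN; rewrite /tau ltnNge nN.
  exact: cvg_series_scale.
have cT x : cvgn (series (fun n => T 0%N n x)).
  by apply: dominated_series_cvg cM => n; exact: TM.
exists (fun x => limn (series (fun n => T 0%N n x))); split.
- apply: (@Ck_circle_series _ k T M).
  + move=> j n x jk; have [dU _ _ _ _] := HU n.
    exact: (is_deriveB (is_derive_translate (dU j _ jk))
      (is_derive_translate (dU j _ jk))).
  + move=> n x; have [_ cU _ _ _] := HU n.
    have sh c : (y + c) @[y --> x] --> x + c.
      by apply: cvgD; [exact: cvg_id | exact: cvg_cst].
    by apply: cvgB; [apply: (cvg_comp _ _ (sh (- G n.+1)))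
      | apply: (cvg_comp _ _ (sh (- G n)))]; exact: cU.
  + exact: TM.
  + move=> n x; have [_ _ pU _ _] := HU n.
    by rewrite /T (addrAC x 1 (- G n.+1)) (addrAC x 1 (- G n)) !pU.
  + exact: cM.
- apply: (@sup_norm_lt _ (limn (series M))).
    by move=> x; apply: dominated_series_le cM => n; exact: TM.
  rewrite (cvg_lim (@Rhausdorff R) cutM); apply: le_lt_trans HN1.
  rewrite lerD2l lerN2; apply: nondecreasing_series; last exact: leq_maxl.
  by move=> n _ _; rewrite mulr_ge0// ltW.
- apply: (@cohomologous_of_smoothing_data alpha beta b q tau (fun n => U n 0%N)) => //.
  by move=> n; have [] := HU n.
Qed.

Lemma exp_bounds (L : R) : 0 < L ->
  [/\ L <= 2 * expR (L / 2), expR (- (L / 4)) <= 4 / L & 2 <= expR (1 : R)].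
Proof.
move=> L0; have h2 := expR_ge1Dx (L / 2); have h4 := expR_ge1Dx (L / 4).
have h1 := expR_ge1Dx (1 : R).
split; [lra | | lra].
rewrite expRN -[4 / L]invf_div lef_pV2 ?posrE ?expR_gt0 ?divr_gt0//; lra.
Qed.

(** The kernel of degree at most [L / 4], with [L = - ln ||q alpha||]: on a
    fixed strip its growth is beaten by [||q alpha|| = exp (- L)], and [2 ^ l]
    beats the number [|b|] of passages, so that everything is of order
    [q l / L]. *)
Lemma analytic_smoothing (alpha : R) (b : int) (q l : nat) :
  let D := dist_int (q%:R * alpha) in
  let L := - ln D in
  (0 < q)%N -> 0 < D -> (1 < l)%N -> `|b%:~R| <= 2 ^+ l :> R ->
  16 * (q%:R * l%:R) <= L ->
  exists u : R -> R,
    smoothing_data alpha b q (34 * (q%:R * l%:R / L)) u /\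
    forall y gamma, dist_int gamma <= `|b%:~R| * D -> exists c : nat -> R,
      (forall h, pseries c h @ \oo --> u (y + h - gamma) - u (y + h)) /\
      forall J, \sum_(0 <= j < J) `|c j| * (2 * pi)^-1 ^+ j <=
        4 * (q%:R * l%:R / L).
Proof.
move=> D L q0 D0 l1 bl Lbig.
have q1 : 1 <= q%:R :> R by rewrite ler1n.
have l2 : 2 <= l%:R :> R by rewrite ler_nat.
have ql : l%:R <= q%:R * l%:R :> R by rewrite ler_peMl.
have L0 : 0 < L by nra.
set tau := q%:R * l%:R / L.
have tauL : tau * L = q%:R * l%:R by rewrite divfK// gt_eqF.
have tau0 : 0 < tau by rewrite divr_gt0// mulr_gt0; lra.
have DE : D = expR (- L) by rewrite /L opprK lnK.
pose X : R := L / (4 * l%:R); pose d := Num.truncn X.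
have lp : 0 < 4 * l%:R :> R by lra.
have X0 : 4 <= X by rewrite ler_pdivlMr//; nra.
have dX : d%:R <= X by rewrite truncn_le //; lra.
have Xd : X < d%:R + 1 by rewrite natr1; exact: truncnS_gt.
have XL : X * (4 * l%:R) = L by rewrite divfK// gt_eqF.
have d1 : 3 <= d%:R :> R by lra.
have d0 : (0 < d)%N by rewrite -(ltr0n R); lra.
have [N [a [Nld a0 aS He]]] := trig_sawtooth_error R d0 l1.
have ldL : (l * d)%:R <= L / 4 :> R.
  have h : l%:R * d%:R <= l%:R * X by rewrite ler_wpM2l.
  by rewrite natrM; lra.
have [LE E4 e2] := exp_bounds L0.
have bE : `|b%:~R| <= expR (L / 16).
  apply: (le_trans bl); apply: (@le_trans _ _ (expR l%:R)).
    by rewrite -[X in expR X]mul1r expRM_natr lerXn2r ?nnegrE ?expR_ge0.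
  by rewrite ler_expR; lra.
have q2d : q%:R * (2 / d%:R) <= 16 * tau.
  rewrite mulrA ler_pdivrMr; last lra.
  have tX : tau * X = q%:R / 4.
    rewrite /tau /X; field.
    by rewrite !gt_eqF//; lra.
  nra.
exists (trig_sawtooth N a); split.
  split; first exact: trig_sawtooth_periodic.
    by apply: continuous_measurable_fun; exact: continuous_trig_sawtooth.
  exists (2 / d%:R), (4 * l%:R / (4 ^+ l * d%:R ^+ 2)); split => //.
    by rewrite divr_gt0//; lra.
  rewrite -/D mulrDr.
  (* the total 34 is 16 + 2 + 16 *)
  have h2 : q%:R * (`|b%:~R| * D) <= 2 * tau.
    have qt : q%:R <= tau * L by rewrite tauL ler_peMr; lra.
    have bD : `|b%:~R| * D <= expR (- (L / 2)).
      apply: (@le_trans _ _ (expR (L / 16) * D)); first by rewrite ler_wpM2r// ltW.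
      by rewrite DE -expRD ler_expR; lra.
    have LD : L * (`|b%:~R| * D) <= 2.
      apply: (@le_trans _ _ (2 * expR (L / 2) * expR (- (L / 2)))).
        by apply: ler_pM => //; [exact: ltW | rewrite mulr_ge0// ltW].
      by rewrite -mulrA -expRD subrr expR0 mulr1.
    apply: (@le_trans _ _ (tau * L * (`|b%:~R| * D))).
      by rewrite ler_wpM2r// mulr_ge0// ltW.
    by rewrite -mulrA mulrC ler_wpM2r// ltW.
  have h3 : `|b%:~R| * q%:R * (4 * l%:R / (4 ^+ l * d%:R ^+ 2) / (2 / d%:R))
      <= q%:R * (2 / d%:R) :> R.
    have l2l : l%:R <= 2 ^+ l :> R by rewrite -natrX ler_nat ltnW// ltn_expl.
    have e4 : 4 ^+ l = 2 ^+ l * 2 ^+ l :> R by rewrite -exprMn; congr (_ ^+ _); ring.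
    have p2 : 0 < 2 ^+ l :> R by rewrite exprn_gt0.
    apply: (@le_trans _ _
        ((q%:R * (2 / d%:R)) * ((`|b%:~R| / 2 ^+ l) * (l%:R / 2 ^+ l)))).
      rewrite le_eqVlt; apply/orP; left; apply/eqP; rewrite e4; field.
      by rewrite !gt_eqF//; lra.
    rewrite ler_piMr ?mulr_ge0//.
    have b1 : `|b%:~R| / 2 ^+ l <= 1 :> R by rewrite ler_pdivrMr// mul1r.
    have b2 : l%:R / 2 ^+ l <= 1 :> R by rewrite ler_pdivrMr// mul1r.
    have b10 : 0 <= `|b%:~R| / 2 ^+ l :> R by rewrite divr_ge0// ltW.
    have b20 : 0 <= l%:R / 2 ^+ l :> R by rewrite divr_ge0// ltW.
    by rewrite mulr_ile1.
  lra.
move=> y gamma dg; have [c [c1 c2]] := trig_increment_pseries y gamma a0 aS.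
exists c; split => // J; apply: le_trans (c2 J) _.
apply: (@le_trans _ _ (expR (L / 4) * (expR (L / 16) * expR (- L)) * expR (L / 4))).
  apply: ler_pM; [|exact: expR_ge0| |].
  - by rewrite mulr_ge0// dist_int_ge0.
  - apply: ler_pM; rewrite ?dist_int_ge0//.
      apply: (le_trans ldL); apply: le_trans (expR_ge1Dx _); lra.
    apply: (le_trans dg); rewrite -DE ler_wpM2r// ltW//.
  - rewrite ler_expR; apply: le_trans ldL; rewrite ler_nat ltnW//.
rewrite -!expRD; apply: (@le_trans _ _ (expR (- (L / 4)))).
  by rewrite ler_expR; lra.
apply: (le_trans E4); rewrite ler_pdivrMr// -mulrA tauL; nra.
Qed.

(** The exponent [l n] is the least with [2 ^ l > n |b|], up to a shift of the
    index; it is comparable to [ln (n |b|)], so that the bounds of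
    [analytic_smoothing] are summable by hypothesis. *)
Lemma analytic_cohomologous (alpha beta : R) (b : nat -> int) (q : nat -> nat) :
  let G N := \sum_(0 <= n < N) (b n)%:~R * (q n)%:R * alpha in
  let D n := dist_int ((q n)%:R * alpha) in
  (forall n, b n != 0) -> (forall n, (0 < q n)%N) -> (forall n, 0 < D n) ->
  dist_int (G N - beta) @[N --> \oo] --> (0 : R) ->
  cvgn (series (fun n =>
    (q n)%:R * ln (n.+1%:R * `|(b n)%:~R|) / - ln (D n))) ->
  forall eps : R, 0 < eps ->
    exists psi : R -> R,
      [/\ analytic_circle psi, (sup_norm psi < eps%:E)%E
        & additively_cohomologous alpha (phi beta) psi].
Proof.
move=> G D b0 q0 D0 dG; set s := (fun n => _ / _) => cs eps eps0.
have L0 n : 0 < - ln (D n).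
  rewrite oppr_gt0 ln_lt0// D0 (le_lt_trans (dist_int_le_half _))//; lra.
pose B n := (n.+1 * `|b n|)%N.
have BE n : n.+1%:R * `|(b n)%:~R| = (B n)%:R :> R.
  by rewrite /B natrM natr_absz intr_norm.
have bB n : (`|b n| <= B n)%N by rewrite leq_pmull.
have B2 n : (0 < n)%N -> (1 < B n)%N.
  by move=> n0; rewrite /B; have := b0 n; rewrite -absz_gt0; nia.
pose l n := (trunc_log 2 (B n)).+1.
have l1 n : (0 < n)%N -> (1 < l n)%N.
  by move=> /B2 h; rewrite /l ltnS trunc_log_gt0//= h.
have bl n : `|(b n)%:~R| <= 2 ^+ l n :> R.
  rewrite -intr_norm -abszE -natrX ler_nat.
  by apply: leq_trans (bB n) _; apply/ltnW/trunc_log_ltn.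
have ln2 : 0 < ln 2 :> R by rewrite ln_gt0//; lra.
pose c0 : R := 2 / ln 2.
have lB n : (0 < n)%N -> (l n)%:R <= c0 * ln (B n)%:R.
  move=> n0; set t := trunc_log 2 (B n).
  have t1 : 1 <= t%:R :> R by rewrite ler1n trunc_log_gt0//= B2.
  have tB : t%:R * ln 2 <= ln (B n)%:R :> R.
    rewrite mulr_natl -lnXn// ler_ln ?posrE ?exprn_gt0 ?ltr0n//; last first.
      exact: ltnW (B2 n n0).
    by rewrite -natrX ler_nat trunc_logP// ltnW// B2.
  rewrite /c0 mulrAC ler_pdivlMr// /l -natr1 -/t; nra.
pose tau n := (q n)%:R * (l n)%:R / - ln (D n).
have tau0 n : 0 <= tau n by rewrite divr_ge0 ?mulr_ge0// ltW.
have taus n : (0 < n)%N -> tau n <= c0 * s n.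
  move=> n0; rewrite /tau /s BE mulrA ler_pM2r ?invr_gt0// mulrCA ler_wpM2l//.
  exact: lB.
have ctau : cvgn (series tau).
  apply: (@cvg_series_eventually _ (fun n => if (n < 1)%N then 0 else tau n) _ 1%N).
    by move=> n n1; rewrite ltnNge n1.
  have c1 := @cvg_series_cut _ (fun n => c0 * s n) 1%N (@cvg_series_scale _ s c0 cs).
  have c2 : cvgn (series (fun n => if (n < 1)%N then 0 else c0 * s n)).
    by apply/cvg_ex; eexists; exact: c1.
  apply: dominated_series_cvg c2 => n; case: ltnP => n1; first by rewrite normr0.
  by rewrite ger0_norm// taus.
have c4 := @cvg_series_scale _ tau 4 ctau.
have [N1 HN1] := series_tail_lt c4 eps0.
have [N2 _ HN2] : \forall n \near \oo, tau n < 1 / 16.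
  have h16 : 0 < 1 / 16 :> R by rewrite divr_gt0.
  have /cvgrPdist_lt/(_ _ h16) := cvg_series_cvg_0 ctau.
  by apply: filterS => n; rewrite sub0r normrN => /ltr_normlW.
(* the first term is discarded since its logarithm may vanish *)
pose N0 := maxn 1 (maxn N1 N2).
pose M n := if (n < N0)%N then 0 else 4 * tau n.
pose tau' n := if (n < N0)%N then (q n)%:R * (1 + `|(b n)%:~R| * D n)
  else 34 * tau n.
have pi20 : 0 < (2 * pi)^-1 :> R by rewrite invr_gt0 mulr_gt0 ?pi_gt0.
have /choice[u Hu] : forall n, exists u : R -> R,
    smoothing_data alpha (b n) (q n) (tau' n) u /\
    forall y, exists c : nat -> R,
      (forall h, pseries c h @ \oo -->
         u (y + h - (b n)%:~R * (q n)%:R * alpha) - u (y + h)) /\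
      forall J, \sum_(0 <= j < J) `|c j| * (2 * pi)^-1 ^+ j <= M n.
  move=> n; rewrite /M /tau'; case: ltnP => nN.
    exists (fun=> 0); split; first exact: smoothing_data_trivial.
    move=> y; exists (fun=> 0); split => [h|J].
      rewrite (_ : pseries _ h = fun=> 0) ?subrr; first exact: cvg_cst.
      by apply/funext => J; rewrite /pseries /series /= big1// => j _; rewrite mul0r.
    by rewrite big1// => j _; rewrite normr0 mul0r.
  move: (nN); rewrite !geq_max => /and3P[n1 _ n2].
  have [|u [u1 u2]] := analytic_smoothing (q0 n) (D0 n) (l1 n n1) (bl n).
    have := HN2 n n2; rewrite /tau /= ltr_pdivrMr// -/(D n); lra.
  exists u; split => // y; apply: u2.
  by rewrite -mulrA; exact: dist_intMz.
pose t n x := u n (x - G n.+1) - u n (x - G n).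
have GS n x : x - G n.+1 = x - G n - (b n)%:~R * (q n)%:R * alpha.
  by rewrite /G big_nat_recr//= opprD addrA.
have /choice[a Ha] : forall x : R, exists a : nat -> nat -> R, forall n,
    (forall h, pseries (a n) h @ \oo --> t n (x + h)) /\
    forall J, \sum_(0 <= j < J) `|a n j| * (2 * pi)^-1 ^+ j <= M n.
  move=> x; suff /choice[a Ha] : forall n, exists c : nat -> R,
      (forall h, pseries c h @ \oo --> t n (x + h)) /\
      forall J, \sum_(0 <= j < J) `|c j| * (2 * pi)^-1 ^+ j <= M n by exists a.
  move=> n; have [_ /(_ (x - G n))[c [c1 c2]]] := Hu n.
  exists c; split => // h; rewrite /t GS (addrAC x h (- G n)).
  exact: c1.
have tM n x : `|t n x| <= M n.
  have [a1 a2] := Ha x n; rewrite -[x]addr0.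
  have h0 : `|0 : R| <= (2 * pi)^-1 by rewrite normr0 ltW.
  by have [] := pseries_lim_le h0 a2 (a1 0).
have cutM := cvg_series_cut (N := N0) c4.
have cM : cvgn (series M) by apply/cvg_ex; eexists; exact: cutM.
have ctau' : cvgn (series tau').
  apply: (@cvg_series_eventually _ (fun n => 34 * tau n) _ N0).
    by move=> n nN; rewrite /tau' ltnNge nN.
  exact: cvg_series_scale.
exists (fun x => limn (series (t^~ x))); split.
- apply: (@analytic_circle_series _ t M a (2 * pi)^-1) => //.
  + move=> n x; have [[pu _ _] _] := Hu n.
    by rewrite /t (addrAC x 1 (- G n.+1)) (addrAC x 1 (- G n)) !pu.
  + by move=> x n h _; have [a1 _] := Ha x n.
  + by move=> x n; have [_ a2] := Ha x n.
- apply: (@sup_norm_lt _ (limn (series M))).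
    by move=> x; apply: dominated_series_le cM => n; exact: tM.
  rewrite (cvg_lim (@Rhausdorff R) cutM); apply: le_lt_trans HN1.
  rewrite lerD2l lerN2; apply: nondecreasing_series.
    by move=> n _ _; rewrite mulr_ge0.
  by rewrite /N0 !leq_max leqnn !orbT.
- apply: (@cohomologous_of_smoothing_data alpha beta b q tau' u) => //.
    by move=> n; have [] := Hu n.
  by move=> x; apply: dominated_series_cvg cM => n; exact: tM.
Qed.

End assembly.

(** * Smooth functions cohomologous to [phi beta] *)

Lemma nneseries1_cvg (R : realType) (f : nat -> R) : (forall n, 0 <= f n) ->
  (\sum_(1 <= n <oo) (f n)%:E < +oo)%E -> cvgn (series (fun n => f n.+1)).
Proof.
move=> f0 fs; apply: nnseries_is_cvg => // .
rewrite (eq_eseriesr (g := fun n => (f (n + 1)%N)%:E)); last first.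
  by move=> n _; rewrite addn1.
by rewrite (nneseries_addn 1 (f := fun n => (f n)%:E))// => n; rewrite lee_fin.
Qed.

Theorem proposition10 (R : realType) (alpha : R) (q b : nat -> int)
    (alpha_irr : irrational alpha)
    (q_sub : cf_den_subsequence alpha q)
    (b_neq0 : forall n, (1 <= n)%N -> b n != 0)
    (beta : R)
    (beta_sum : series_mod1 (fun n => (b n)%:~R * (q n)%:~R * alpha) beta) :
  (forall k : nat,
     (\sum_(1 <= n <oo)
        ((`|(b n)%:~R| * (q n)%:~R ^+ k.+1 * dist_int ((q n)%:~R * alpha))
           `^ (k.+2%:R)^-1)%:E < +oo)%E ->
     forall eps : R, 0 < eps ->
     exists psi : R -> R,
       [/\ Ck_circle k psi, (sup_norm psi < eps%:E)%E
         & additively_cohomologous alpha (phi beta) psi])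
  /\
  ((\sum_(1 <= n <oo)
      ((q n)%:~R * ln (n%:R * `|(b n)%:~R|)
         / - ln (dist_int ((q n)%:~R * alpha)))%:E < +oo)%E ->
   forall eps : R, 0 < eps ->
   exists psi : R -> R,
     [/\ analytic_circle psi, (sup_norm psi < eps%:E)%E
       & additively_cohomologous alpha (phi beta) psi]).
Proof.
have q1 n : 1 <= q n.+1.
  by case: q_sub => sigma [_ ->//]; exact: cf_den_ge1.
pose q' n := `|q n.+1|%N; pose b' n := b n.+1.
have qE n : q n.+1 = (q' n)%:Z by rewrite gez0_abs// (le_trans _ (q1 n)).
have q'0 n : (0 < q' n)%N by have := q1 n; rewrite qE; lia.
have b'0 n : b' n != 0 by exact: b_neq0.
have D0 n : 0 < dist_int ((q' n)%:R * alpha) by exact: dist_int_irrational_gt0.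
have dG : dist_int (\sum_(0 <= n < N) (b' n)%:~R * (q' n)%:R * alpha - beta)
    @[N --> \oo] --> (0 : R).
  move: beta_sum; rewrite /series_mod1; under eq_fun => N.
    rewrite big_add1 /=; under eq_bigr do rewrite qE.
    over.
  exact.
split=> [k sum_fin|sum_fin] eps eps0.
  apply: (Ck_cohomologous b'0 q'0 D0 dG _ eps0).
  have c := @nneseries1_cvg R _ (fun n => powR_ge0 _ _) sum_fin.
  by apply: (cvg_series_eventually (N := 0) _ c) => n _; rewrite qE.
apply: (analytic_cohomologous b'0 q'0 D0 dG _ eps0).
have := @nneseries1_cvg R _ _ sum_fin.
suff f0 n : 0 <= (q n)%:~R * ln (n%:R * `|(b n)%:~R|)
    / - ln (dist_int ((q n)%:~R * alpha)).
  move=> /(_ f0) c.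
  by apply: (cvg_series_eventually (N := 0) _ c) => n _; rewrite qE.
case: n => [|n]; first by rewrite mul0r ln0// mulr0 mul0r.
rewrite qE divr_ge0//.
  rewrite mulr_ge0// ln_ge0// -intr_norm -natr1.
  have : 1 <= `|b n.+1|%:~R :> R by rewrite ler1z; have := b'0 n; rewrite /b'; lia.
  by have := ler0n R n; nra.
rewrite oppr_ge0 ln_le0// (le_trans (dist_int_le_half _))//; lra.
Qed.
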